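(* Let $P,F,A_I,A_O,B_I,B_O,E_A,E_B$ be finite-dimensional Hilbert spaces with $d_{A_I}=d_{A_O}=:d_A$, $d_{B_I}=d_{B_O}=:d_B$, and $d_P=d_F=d_Ad_{E_A}=d_Bd_{E_B}$. Let $(\Pi_A,\Phi_A)$ be a frame function for Alice and $(\Pi_B,\Phi_B)$ a frame function for Bob which are consistent, i.e. for all unitaries $U_A:A_I\to A_O$, $U_B:B_I\to B_O$, $$\Phi_A(U_B)(U_A\otimes\mathbb{1}^{E_A})\Pi_A(U_B)=\Phi_B(U_A)(U_B\otimes\mathbb{1}^{E_B})\Pi_B(U_A)=:\mathcal{G}(U_A,U_B).$$ Let $\{U_i:A_I\to A_O\}_{i=1}^{d_A^2}$ and $\{V_j:B_I\to B_O\}_{j=1}^{d_B^2}$ be orthonormal bases of unitaries, and define $$|w\rangle=\frac{1}{d_Ad_B}\sum_{i,j}|\mathcal{G}(U_i,V_j)\rangle\!\rangle^{PF}|U_i^*\rangle\!\rangle^{A_IA_O}|V_j^*\rangle\!\rangle^{B_IB_O}.$$ Then $W=|w\rangle\langle w|$ is a valid process matrix and is pure.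
   Context: A frame function for Alice is a pair of functions $(\Pi_A,\Phi_A)$, each sending linear maps $T_B:B_I\to B_O$ to linear maps $\Pi_A(T_B):P\to A_I\otimes E_A$ and $\Phi_A(T_B):A_O\otimes E_A\to F$, such that $\Pi_A(U_B),\Phi_A(U_B)$ are unitary whenever $U_B$ is unitary (no linearity in $T_B$ is required). A frame function for Bob is defined symmetrically: $\Pi_B(T_A):P\to B_I\otimes E_B$, $\Phi_B(T_A):B_O\otimes E_B\to F$ for linear $T_A:A_I\to A_O$, unitary whenever $T_A$ is unitary. All Hilbert spaces are finite-dimensional with fixed computational bases; juxtaposition of spaces denotes tensor product. For a linear map $K:X\to Y$, $|K\rangle\!\rangle^{XY}=\sum_i|i\rangle^X\otimes(K|i\rangle)^Y$; $K^*$ is entrywise complex conjugation. A set $\{U_i\}_{i=1}^{d^2}$ of unitaries $X\to Y$ ($d=\dim X=\dim Y$) is an orthonormal basis of unitaries if $\{|U_i\rangle\!\rangle\}$ is a basis of $X\otimes Y$ and $\langle\!\langle U_i|U_j\rangle\!\rangle=d\,\delta_{ij}$. For an operator $W$ on $X\otimes Y$, $W^{T_X}$ is its partial transpose on $X$. The Choi operator of $\mathcal{M}:\mathcal{L}(X)\to\mathcal{L}(Y)$ is $\sum_{ij}|i\rangle\langle j|\otimes\mathcal{M}(|i\rangle\langle j|)$. A process matrix is an operator $W$ on $PFA_IA_OB_IB_O$ such that for all finite-dimensional ancilla spaces $A_I',A_O',B_I',B_O'$ and all CPTP maps $\mathcal{M}_x:\mathcal{L}(A_IA_I')\to\mathcal{L}(A_OA_O')$,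 $\mathcal{M}_y:\mathcal{L}(B_IB_I')\to\mathcal{L}(B_OB_O')$ with Choi operators $M_x,M_y$, the operator $\mathrm{tr}_{A_IA_OB_IB_O}\big(W^{T_{A_IA_OB_IB_O}}(M_x\otimes M_y)\big)$ is the Choi operator of a CPTP map from $PA_I'B_I'$ to $FA_O'B_O'$. It is pure if for all ancilla spaces with $d_{A_I}d_{A_I'}=d_{A_O}d_{A_O'}$, $d_{B_I}d_{B_I'}=d_{B_O}d_{B_O'}$, $d_Pd_{A_I'}d_{B_I'}=d_Fd_{A_O'}d_{B_O'}$, and all unitaries $U:A_IA_I'\to A_OA_O'$, $V:B_IB_I'\to B_OB_O'$, the operator $\mathrm{tr}_{A_IA_OB_IB_O}\big(W^{T_{A_IA_OB_IB_O}}(|U\rangle\!\rangle\langle\!\langle U|\otimes|V\rangle\!\rangle\langle\!\langle V|)\big)$ is the Choi operator of a unitary channel from $PA_I'B_I'$ to $FA_O'B_O'$. *)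

(* Defs.v *)
(* Finite-dimensional Hilbert spaces with a fixed
   computational basis are modelled by finite types X (the basis);
   the dimension d_X is #|X|; the tensor product X (x) Y is the product
   type X * Y (basis |x>|y> <-> (x,y)).  Scalars live in an arbitrary
   numClosedFieldType C (e.g. the complex numbers R[i] for R : realType);
   ^* is complex conjugation and 0 <= z means "z is real and nonnegative". *)
From mathcomp Require Import all_boot all_order all_algebra.
Set Implicit Arguments.
Unset Strict Implicit.
Unset Printing Implicit Defensive.
Import Order.TTheory GRing.Theory Num.Theory.
Local Open Scope ring_scope.

Section QuantumDefs.
Variable C : numClosedFieldType.

Definition vec (X : finType) := X -> C.
(* linear maps X -> Y, as matrices:  lin X Y  applied to y x  =  <y|K|x> *)
Definition lin (X Y : finType) := Y -> X -> C.
Definition superop (X Y : finType) := lin X X -> lin Y Y.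
Arguments vec X%_type.
Arguments lin X%_type Y%_type.
Arguments superop X%_type Y%_type.

Definition comp (X Y Z : finType) (K : lin Y Z) (L : lin X Y) : lin X Z :=
  fun z x => \sum_(y : Y) K z y * L y x.
Definition adj (X Y : finType) (K : lin X Y) : lin Y X :=
  fun x y => (K y x)^*.
Definition idop (X : finType) : lin X X := fun x x' => (x == x')%:R.
Definition cconj (X Y : finType) (K : lin X Y) : lin X Y :=
  fun y x => (K y x)^*.
Definition tensor (X1 Y1 X2 Y2 : finType) (K : lin X1 Y1) (L : lin X2 Y2)
  : lin (X1 * X2) (Y1 * Y2) := fun y x => K y.1 x.1 * L y.2 x.2.

Definition unitary (X Y : finType) (U : lin X Y) : Prop :=
  (forall x x', comp (adj U) U x x' = idop x x') /\
  (forall y y', comp U (adj U) y y' = idop y y').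

(* |K>>^{XY} = sum_i |i>^X (x) (K|i>)^Y ; its (i,y) coefficient is <y|K|i> *)
Definition dket (X Y : finType) (K : lin X Y) : vec (X * Y) :=
  fun p => K p.2 p.1.

Definition inner (T : finType) (u v : vec T) : C := \sum_(t : T) (u t)^* * v t.
Definition proj (T : finType) (u : vec T) : lin T T := fun t t' => u t * (u t')^*.

Definition trace (T : finType) (Z : lin T T) : C := \sum_(t : T) Z t t.

Definition is_basis (T : finType) (n : nat) (f : 'I_n -> vec T) : Prop :=
  (forall c : 'I_n -> C, (forall t, \sum_(i < n) c i * f i t = 0) ->
      forall i, c i = 0) /\
  (forall v : vec T, exists c : 'I_n -> C,
      forall t, v t = \sum_(i < n) c i * f i t).

Definition onb_unitaries (X Y : finType) (n : nat) (U : 'I_n -> lin X Y) : Prop :=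
  [/\ #|X| = #|Y|, n = (#|X| ^ 2)%N, (forall i, unitary (U i)),
      is_basis (fun i => dket (U i)) &
      (forall i j, inner (dket (U i)) (dket (U j)) = (#|X| * (i == j))%:R)].

Definition psd (T : finType) (Z : lin T T) : Prop :=
  forall v : vec T, 0 <= \sum_(t : T) \sum_(t' : T) (v t)^* * Z t t' * v t'.

Definition linear_sop (X Y : finType) (M : superop X Y) : Prop :=
  forall (a : C) (Z1 Z2 : lin X X) y y',
    M (fun x x' => a * Z1 x x' + Z2 x x') y y' = a * M Z1 y y' + M Z2 y y'.

(* (M (x) id_R) applied to an operator on X (x) R *)
Definition ext_sop (X Y R : finType) (M : superop X Y) (Z : lin (X * R) (X * R))
  : lin (Y * R) (Y * R) :=
  fun p q => M (fun x x' => Z (x, p.2) (x', q.2)) p.1 q.1.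

Definition CP (X Y : finType) (M : superop X Y) : Prop :=
  forall (R : finType) (Z : lin (X * R) (X * R)), psd Z -> psd (ext_sop M Z).

Definition TP (X Y : finType) (M : superop X Y) : Prop :=
  forall Z : lin X X, trace (M Z) = trace Z.

Definition CPTP (X Y : finType) (M : superop X Y) : Prop :=
  [/\ linear_sop M, CP M & TP M].

(* Choi operator  sum_{ij} |i><j| (x) M(|i><j|)  on X (x) Y *)
Definition choi (X Y : finType) (M : superop X Y) : lin (X * Y) (X * Y) :=
  fun p q => M (fun x x' => ((x == p.1) && (x' == q.1))%:R) p.2 q.2.

Definition unitary_channel (X Y : finType) (T : lin X Y) : superop X Y :=
  fun Z => comp T (comp Z (adj T)).

Section Process.
Variables P F AI AO BI BO : finType.
Local Notation S := ((P * F) * ((AI * AO) * (BI * BO)))%type.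

Definition ptransAB (W : lin S S) : lin S S :=
  fun s s' => W (s.1, s'.2) (s'.1, s.2).

(* tr_{A_I A_O B_I B_O}( W^{T_{A_I A_O B_I B_O}} (Mx (x) My) ), where
   Mx acts on (A_I A_I')(A_O A_O') and My on (B_I B_I')(B_O B_O');
   the result acts on (P F)((A_I' A_O')(B_I' B_O')). *)
Definition link (AI' AO' BI' BO' : finType) (W : lin S S)
  (Mx : lin ((AI * AI') * (AO * AO')) ((AI * AI') * (AO * AO')))
  (My : lin ((BI * BI') * (BO * BO')) ((BI * BI') * (BO * BO')))
  : lin ((P * F) * ((AI' * AO') * (BI' * BO')))
        ((P * F) * ((AI' * AO') * (BI' * BO'))) :=
  fun x y =>
    \sum_(ab : (AI * AO) * (BI * BO)) \sum_(ab2 : (AI * AO) * (BI * BO))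
      ptransAB W (x.1, ab) (y.1, ab2) *
      (Mx ((ab2.1.1, x.2.1.1), (ab2.1.2, x.2.1.2))
          ((ab.1.1, y.2.1.1), (ab.1.2, y.2.1.2)) *
       My ((ab2.2.1, x.2.2.1), (ab2.2.2, x.2.2.2))
          ((ab.2.1, y.2.2.1), (ab.2.2, y.2.2.2))).

(* Q (on P F A_I' A_O' B_I' B_O') is the Choi operator of N :
   L(P A_I' B_I') -> L(F A_O' B_O'), after the canonical reordering of
   tensor factors. *)
Definition is_choi_of (AI' AO' BI' BO' : finType)
  (Q : lin ((P * F) * ((AI' * AO') * (BI' * BO')))
           ((P * F) * ((AI' * AO') * (BI' * BO'))))
  (N : superop ((P * AI') * BI') ((F * AO') * BO')) : Prop :=
  forall p f ai ao bi bo p2 f2 ai2 ao2 bi2 bo2,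
    Q ((p, f), ((ai, ao), (bi, bo))) ((p2, f2), ((ai2, ao2), (bi2, bo2))) =
    choi N (((p, ai), bi), ((f, ao), bo)) (((p2, ai2), bi2), ((f2, ao2), bo2)).

Definition process_matrix (W : lin S S) : Prop :=
  forall (AI' AO' BI' BO' : finType)
         (Mx : superop (AI * AI') (AO * AO')) (My : superop (BI * BI') (BO * BO')),
    CPTP Mx -> CPTP My ->
    exists N : superop ((P * AI') * BI') ((F * AO') * BO'),
      CPTP N /\ is_choi_of (link W (choi Mx) (choi My)) N.

Definition pure_process (W : lin S S) : Prop :=
  forall (AI' AO' BI' BO' : finType),
    (#|AI| * #|AI'| = #|AO| * #|AO'|)%N ->
    (#|BI| * #|BI'| = #|BO| * #|BO'|)%N ->
    (#|P| * #|AI'| * #|BI'| = #|F| * #|AO'| * #|BO'|)%N ->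
    forall (U : lin (AI * AI') (AO * AO')) (V : lin (BI * BI') (BO * BO')),
      unitary U -> unitary V ->
      exists T : lin ((P * AI') * BI') ((F * AO') * BO'),
        unitary T /\
        is_choi_of (link W (proj (dket U)) (proj (dket V))) (unitary_channel T).

End Process.

Definition frame_fun_A (P F AI AO BI BO EA : finType)
  (PiA : lin BI BO -> lin P (AI * EA)) (PhiA : lin BI BO -> lin (AO * EA) F) : Prop :=
  forall UB : lin BI BO, unitary UB -> unitary (PiA UB) /\ unitary (PhiA UB).

Definition frame_fun_B (P F AI AO BI BO EB : finType)
  (PiB : lin AI AO -> lin P (BI * EB)) (PhiB : lin AI AO -> lin (BO * EB) F) : Prop :=
  forall UA : lin AI AO, unitary UA -> unitary (PiB UA) /\ unitary (PhiB UA).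

Definition GA (P F AI AO BI BO EA : finType)
  (PiA : lin BI BO -> lin P (AI * EA)) (PhiA : lin BI BO -> lin (AO * EA) F)
  (UA : lin AI AO) (UB : lin BI BO) : lin P F :=
  comp (PhiA UB) (comp (tensor UA (@idop EA)) (PiA UB)).

Definition GB (P F AI AO BI BO EB : finType)
  (PiB : lin AI AO -> lin P (BI * EB)) (PhiB : lin AI AO -> lin (BO * EB) F)
  (UA : lin AI AO) (UB : lin BI BO) : lin P F :=
  comp (PhiB UA) (comp (tensor UB (@idop EB)) (PiB UA)).

Definition wvec (P F AI AO BI BO EA : finType)
  (PiA : lin BI BO -> lin P (AI * EA)) (PhiA : lin BI BO -> lin (AO * EA) F)
  (n m : nat) (U : 'I_n -> lin AI AO) (V : 'I_m -> lin BI BO)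
  : vec ((P * F) * ((AI * AO) * (BI * BO))) :=
  fun s => ((#|AI| * #|BI|)%:R)^-1 *
    \sum_(i < n) \sum_(j < m)
      dket (GA PiA PhiA (U i) (V j)) s.1 *
      (dket (cconj (U i)) s.2.1 * dket (cconj (V j)) s.2.2).

End QuantumDefs.
Arguments vec C X%_type.
Arguments lin C X%_type Y%_type.
Arguments superop C X%_type Y%_type.

(* Main.v *)
(* The tensor w is the coefficient table, in matrix units, of the bilinear extension
   of G.  Consistency says that with a unitary V inserted for Bob the extension is
   X |-> Phi_A(V) (X (x) 1) Pi_A(V), and symmetrically for Alice.  Hence, for a unitary
   U of Alice acting also on an ancilla, g_U : V |-> G(U, V) is linear and maps
   unitaries to unitaries.  Such a map is the sum of a homomorphic part V (x) 1 and an
   anti-homomorphic part V^T (x) 1, and the point is to exclude the second one.  It is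
   detected by the overlaps M = g_U(E_ij)^* g_U(E_kj), i <> k, which are partial
   isometries depending polynomially on U and its adjoint.  They vanish for
   U = U_A (x) 1 by consistency, and this propagates along a circle U(z) = A + z B of
   unitaries, |z| = 1, because a matrix N of polynomials with N N' N = z^2 N and
   N'(1) = 0 is divisible by every power of z - 1.  As any unitary is connected to a
   local one by circles, the overlaps vanish for all U, so that g_U(Y)^* g_U(Z) depends
   only on Y^* Z, and G maps a pair of isometries (Alice's one being dilated to a
   unitary) to an isometry.  Kraus decompositions turn this into validity, and equality
   of dimensions into purity. *)
Require Import Defs.
From mathcomp Require Import all_boot all_order all_algebra ring.
From Stdlib Require Import FunctionalExtensionality.
Import Defs.
Set Implicit Arguments.
Unset Strict Implicit.
Unset Printing Implicit Defensive.
Import Order.TTheory GRing.Theory Num.Theory.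
Local Open Scope ring_scope.

(** * Linear maps and unitaries *)

Section LinearMaps.
Variable C : numClosedFieldType.
Implicit Types X Y Z : finType.

Lemma conjM (a b : C) : (a * b)^* = a^* * b^*. Proof. exact: rmorphM. Qed.
Lemma conjD (a b : C) : (a + b)^* = a^* + b^*. Proof. exact: rmorphD. Qed.
Lemma conjB (a b : C) : (a - b)^* = a^* - b^*. Proof. exact: rmorphB. Qed.
Lemma conjN (a : C) : (- a)^* = - a^*. Proof. exact: rmorphN. Qed.
Lemma conjV (a : C) : (a^-1)^* = a^*^-1. Proof. exact: fmorphV. Qed.
Lemma conj_sum (I : finType) (P : pred I) (f : I -> C) :
  (\sum_(i | P i) f i)^* = \sum_(i | P i) (f i)^*.
Proof. exact: rmorph_sum. Qed.

Lemma linP X Y (K L : lin C X Y) : (forall y x, K y x = L y x) -> K = L.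
Proof.
by move=> eqKL; apply: functional_extensionality => y;
   apply: functional_extensionality.
Qed.

Lemma compA X Y Z T (K : lin C Z T) (L : lin C Y Z) (M : lin C X Y) :
  comp K (comp L M) = comp (comp K L) M.
Proof.
apply: linP => t x; rewrite /comp.
under eq_bigr do rewrite big_distrr /=.
under [RHS]eq_bigr do rewrite big_distrl /=.
rewrite exchange_big; apply: eq_bigr => y _.
by apply: eq_bigr => z _; rewrite mulrA.
Qed.

Lemma sum_delta X (x : X) (f : X -> C) : \sum_z (x == z)%:R * f z = f x.
Proof.
rewrite (bigD1 x) //= eqxx mul1r big1 ?addr0 // => z.
by rewrite eq_sym => /negPf->; rewrite mul0r.
Qed.

Lemma sum_deltar X (x : X) (f : X -> C) : \sum_z f z * (z == x)%:R = f x.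
Proof. by rewrite -[RHS]sum_delta; apply: eq_bigr => z _; rewrite mulrC eq_sym. Qed.

Lemma comp1o X Y (K : lin C X Y) : comp (@idop C Y) K = K.
Proof. by apply: linP => y x; apply: sum_delta. Qed.

Lemma compo1 X Y (K : lin C X Y) : comp K (@idop C X) = K.
Proof. by apply: linP => y x; apply: sum_deltar. Qed.

Lemma adjK X Y (K : lin C X Y) : adj (adj K) = K.
Proof. by apply: linP => y x; apply: conjCK. Qed.

Lemma adj_comp X Y Z (K : lin C Y Z) (L : lin C X Y) :
  adj (comp K L) = comp (adj L) (adj K).
Proof.
apply: linP => x z; rewrite /adj /comp conj_sum.
by apply: eq_bigr => y _; rewrite conjM mulrC.
Qed.

Definition zop X Y : lin C X Y := fun _ _ => 0.

Lemma comp0o X Y Z (L : lin C X Y) : comp (@zop Y Z) L = @zop X Z.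
Proof. by apply: linP => y x; apply: big1 => t _; rewrite mul0r. Qed.

Lemma compo0 X Y Z (L : lin C Y Z) : comp L (@zop X Y) = @zop X Z.
Proof. by apply: linP => y x; apply: big1 => t _; rewrite mulr0. Qed.

Lemma adj0 X Y : adj (@zop X Y) = @zop Y X.
Proof. by apply: linP => y x; apply: conjC0. Qed.

Lemma adj1 X : adj (@idop C X) = @idop C X.
Proof. by apply: linP => y x; rewrite /adj /idop eq_sym conjC_nat. Qed.

Definition isometry X Y (K : lin C X Y) := comp (adj K) K = @idop C X.

Lemma isometryE X Y (K : lin C X Y) : isometry K ->
  forall x x', \sum_y (K y x)^* * K y x' = (x == x')%:R.
Proof. by move=> isoK x x'; have := congr1 (fun L => L x x') isoK. Qed.

Lemma unitaryP X Y (U : lin C X Y) :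
  unitary U <-> isometry U /\ isometry (adj U).
Proof.
rewrite /isometry adjK; split=> [[UU1 UU2]|[UU1 UU2]].
  by split; apply: linP.
by split=> y y'; rewrite ?UU1 ?UU2.
Qed.

Lemma unitary_adj X Y (U : lin C X Y) : unitary U -> unitary (adj U).
Proof. by move=> /unitaryP[? ?]; apply/unitaryP; rewrite adjK. Qed.

Lemma isometry_comp X Y Z (K : lin C Y Z) (L : lin C X Y) :
  isometry K -> isometry L -> isometry (comp K L).
Proof.
rewrite /isometry => isoK isoL.
by rewrite adj_comp -compA (compA (adj K)) isoK comp1o.
Qed.

Lemma unitary_comp X Y Z (K : lin C Y Z) (L : lin C X Y) :
  unitary K -> unitary L -> unitary (comp K L).
Proof.
move=> /unitaryP[? ?] /unitaryP[? ?]; apply/unitaryP.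
by split; rewrite ?adj_comp; apply: isometry_comp.
Qed.

Lemma unitary_id X : unitary (@idop C X).
Proof. by apply/unitaryP; rewrite adj1; split; rewrite /isometry adj1 comp1o. Qed.

Lemma isometry_reindex X Y X' Y' (h1 : X' -> X) (h2 : Y' -> Y) (K : lin C X Y) :
  injective h1 -> bijective h2 -> isometry K ->
  isometry ((fun y x => K (h2 y) (h1 x)) : lin C X' Y').
Proof.
move=> inj1 bij2 isoK; apply: linP => x x'.
rewrite /idop -(inj_eq inj1) -(isometryE isoK) /comp /adj.
by rewrite [RHS](reindex h2) //; apply: onW_bij.
Qed.

Lemma unitary_reindex X Y X' Y' (h1 : X' -> X) (h2 : Y' -> Y) (K : lin C X Y) :
  bijective h1 -> bijective h2 -> unitary K ->
  unitary ((fun y x => K (h2 y) (h1 x)) : lin C X' Y').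
Proof.
move=> bij1 bij2 /unitaryP[iso1 iso2]; apply/unitaryP; split.
  exact: (isometry_reindex (bij_inj bij1)).
exact: (@isometry_reindex _ _ _ _ h2 h1 (adj K) (bij_inj bij2)).
Qed.

Lemma unitary_perm X Y (h : Y -> X) : bijective h ->
  unitary ((fun y x => (h y == x)%:R) : lin C X Y).
Proof.
move=> bijh; apply: (@unitary_reindex _ _ _ _ id h (@idop C X)) => //.
- by exists id.
- exact: unitary_id.
Qed.

Lemma isometry_tensor X1 Y1 X2 Y2 (K : lin C X1 Y1) (L : lin C X2 Y2) :
  isometry K -> isometry L -> isometry (tensor K L).
Proof.
move=> isoK isoL; apply: linP => -[x1 x2] [x1' x2'].
rewrite /idop xpair_eqE -mulnb natrM -(isometryE isoK) -(isometryE isoL).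
rewrite /comp /adj /tensor big_distrlr pair_big /=.
by apply: eq_bigr => -[y1 y2] _ /=; rewrite conjM mulrACA.
Qed.

Lemma unitary_tensor X1 Y1 X2 Y2 (K : lin C X1 Y1) (L : lin C X2 Y2) :
  unitary K -> unitary L -> unitary (tensor K L).
Proof.
move=> /unitaryP[? ?] /unitaryP[? ?]; apply/unitaryP; split.
  exact: isometry_tensor.
suff -> : adj (tensor K L) = tensor (adj K) (adj L) by apply: isometry_tensor.
by apply: linP => y x; rewrite /adj rmorphM.
Qed.

Lemma unitary_diag X (d : X -> C) : (forall x, (d x)^* * d x = 1) ->
  unitary ((fun y x => d y * (y == x)%:R) : lin C X X).
Proof.
move=> d1; apply/unitaryP; split; apply: linP => x x'; rewrite /comp /adj /idop.
  transitivity (\sum_z (x == z)%:R * ((d z)^* * d z * (z == x')%:R)).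
    by apply: eq_bigr => z _ /=; rewrite conjM conjC_nat [z == x]eq_sym; ring.
  by rewrite sum_delta d1 mul1r.
transitivity (\sum_z (x == z)%:R * (d x * (d x')^* * (z == x')%:R)).
  apply: eq_bigr => z _ /=.
  by rewrite conjCK conjM conjC_nat [z == x']eq_sym; ring.
rewrite sum_delta; case: eqP => [->|_]; last by rewrite mulr0.
by rewrite mulr1 mulrC d1.
Qed.

(** Gives access to two matrix facts: a one-sided inverse of a square matrix is two-sided, and a
    normal matrix is unitarily diagonalizable. *)
Definition mx_of X Y (K : lin C X Y) : 'M[C]_(#|Y|, #|X|) :=
  \matrix_(i, j) K (enum_val i) (enum_val j).

Lemma sum_enum_val X (f : X -> C) : \sum_(i < #|X|) f (enum_val i) = \sum_x f x.
Proof.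
by rewrite [RHS](reindex (@enum_val X X)) //; apply: onW_bij; exact: enum_val_bij.
Qed.

Lemma mx_of_comp X Y Z (K : lin C Y Z) (L : lin C X Y) :
  mx_of (comp K L) = mx_of K *m mx_of L.
Proof.
apply/matrixP => i j; rewrite !mxE -[LHS]sum_enum_val.
by apply: eq_bigr => k _; rewrite !mxE.
Qed.

Lemma mx_of_id X : mx_of (@idop C X) = 1%:M.
Proof. by apply/matrixP => i j; rewrite !mxE /idop (inj_eq enum_val_inj). Qed.

Lemma mx_of_inj X Y : injective (@mx_of X Y).
Proof.
move=> K L /matrixP eqKL; apply: linP => y x.
by have := eqKL (enum_rank y) (enum_rank x); rewrite !mxE !enum_rankK.
Qed.

Lemma isometry_square_unitary X Y (K : lin C X Y) :
  #|X| = #|Y| -> isometry K -> unitary K.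
Proof.
move=> eqXY isoK; apply/unitaryP; split=> //; rewrite /isometry adjK.
apply: mx_of_inj; rewrite mx_of_comp mx_of_id.
move: (congr1 (@mx_of X X) isoK); rewrite mx_of_comp mx_of_id.
move: (mx_of K) (mx_of (adj K)); rewrite eqXY => A B.
exact: mulmx1C.
Qed.
End LinearMaps.

(** * Sesquilinear forms constant on unitaries *)

Section Phases.
Variable C : numClosedFieldType.

(** The points z = 1 and z = -1 give R = c and p = -q; z = ['i] then gives p = q. *)
Lemma phase_coef (R q p c : C) :
  (forall z : C, z^* * z = 1 -> R + z^* * q + z * p = c) -> q = 0.
Proof.
move=> H.
have := H 1; rewrite conjC1 mulr1 => /(_ erefl); rewrite !mul1r => H1.
have := H (-1); rewrite conjN conjC1 mulrNN mulr1 => /(_ erefl).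
rewrite !mulN1r => H2.
have ii : 'i * 'i = -1 :> C by rewrite -expr2 sqrCi.
have := H 'i; rewrite conjCi mulNr ii opprK => /(_ erefl) H3.
have Hi : 'i * (p - q) = 0.
  have -> : 'i * (p - q) = R + - 'i * q + 'i * p - ((R + q + p) + (R - q - p)) / 2.
    by field.
  by rewrite H1 H2 H3; field.
have Hpq : p - q = 0.
  by have /eqP := Hi; rewrite mulf_eq0 (negPf (neq0Ci C)) => /eqP.
have -> : q = ((R + q + p) - (R - q - p)) / 4 - (p - q) / 2 by field.
by rewrite H1 H2 Hpq subrr !mul0r subr0.
Qed.

Definition phases (I : finType) (d : I -> C) := forall i, (d i)^* * d i = 1.

Lemma phases_update (I : finType) (d : I -> C) i z :
  phases d -> z^* * z = 1 -> phases (fun k => if k == i then z * d k else d k).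
Proof.
move=> d1 z1 k; case: ifP => // _.
by rewrite conjM mulrACA z1 d1 mulr1.
Qed.

Lemma phases1 (I : finType) : phases (fun _ : I => 1).
Proof. by move=> i; rewrite conjC1 mulr1. Qed.

(** Multiplying the single phase [d i] by z turns the form into a constant plus conj(z) q + z p,
    where q is conj([d i]) times the off-diagonal sum of row i; [phase_coef] gives q = 0. *)
Lemma phase_form_row (I : finType) (A : I -> I -> C) (c : C) :
  (forall d : I -> C, phases d -> \sum_i \sum_k (d i)^* * d k * A i k = c) ->
  forall i d, phases d -> \sum_(k | k != i) d k * A i k = 0.
Proof.
move=> H i d d1.
have di0 : (d i)^* != 0.
  by apply/eqP => di0; have /eqP := d1 i; rewrite di0 mul0r eq_sym oner_eq0.
suff /eqP : (d i)^* * \sum_(k | k != i) d k * A i k = 0.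
  by rewrite mulf_eq0 (negPf di0) => /eqP.
pose p := \sum_(m | m != i) (d m)^* * d i * A m i.
pose R := \sum_(m | m != i) \sum_(k | k != i) (d m)^* * d k * A m k.
apply: (@phase_coef (A i i + R) _ p c) => z z1.
have := H _ (phases_update i d1 z1).
rewrite (bigD1 i) //= (bigD1 i) //= eqxx.
have -> : (z * d i)^* * (z * d i) = 1.
  by have := phases_update i d1 z1 i; rewrite eqxx.
under [X in _ + X = _ -> _]eq_bigr => m mi do
  rewrite (bigD1 i) //= eqxx (negPf mi).
rewrite big_split /= mul1r => <-.
rewrite -!addrA; congr (_ + _).
rewrite addrC -addrA; congr (_ + _).
  by rewrite mulrA mulr_sumr; apply: eq_bigr => k /negPf->; rewrite conjM; ring.
congr (_ + _); first by rewrite mulr_sumr; apply: eq_bigr => m _; ring.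
by apply: eq_bigr => m mi; apply: eq_bigr => k /negPf->.
Qed.

(** The relations of row i at the all-ones phases and at the phases with a single -1 at k differ
    only in the term of [A i k], which therefore vanishes. *)
Lemma phase_form (I : finType) (A : I -> I -> C) (c : C) :
  (forall d : I -> C, phases d -> \sum_i \sum_k (d i)^* * d k * A i k = c) ->
  (forall i k, i != k -> A i k = 0) /\ \sum_i A i i = c.
Proof.
move=> H.
have offdiag i k : i != k -> A i k = 0.
  move=> ik; have N1 : (-1 : C)^* * -1 = 1 by rewrite conjN conjC1 mulrNN mulr1.
  have := phase_form_row H i (phases_update k (@phases1 I) N1).
  have := phase_form_row H i (@phases1 I).
  rewrite (bigD1 k) 1?eq_sym //= => E1.
  rewrite (bigD1 k) 1?eq_sym //= eqxx.
  rewrite [X in _ + X](eq_bigr (fun m => 1 * A i m)); last first.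
    by move=> m /andP[_ /negPf->].
  move=> E2.
  set S := (X in _ + X = 0) in E1 E2.
  have -> : A i k = ((1 * A i k + S) - (-1 * 1 * A i k + S)) / 2 by field.
  by rewrite E1 E2 subrr mul0r.
split=> //; rewrite -(H _ (@phases1 I)); apply: eq_bigr => i _.
rewrite (bigD1 i) //= big1 ?addr0 ?conjC1 ?mul1r // => k ki.
by rewrite offdiag ?mulr0 // eq_sym.
Qed.
End Phases.

Section Twirl.
Variable C : numClosedFieldType.
Variables X Y : finType.

Lemma unitary_phases (V : lin C X Y) (d : Y -> C) (d' : X -> C) :
  unitary V -> phases d -> phases d' ->
  unitary ((fun i j => d i * V i j * d' j) : lin C X Y).
Proof.
move=> uV d1 d1'.
have := unitary_comp (unitary_diag d1) (unitary_comp uV (unitary_diag d1')).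
congr unitary; apply: linP => i j; rewrite /comp.
transitivity (\sum_y (i == y)%:R * (d i * (V y j * d' j))).
  apply: eq_bigr => y _.
  under eq_bigr do rewrite mulrA; rewrite sum_deltar.
  by ring.
by rewrite sum_delta mulrA.
Qed.

(** An arbitrary bijection is corrected by two transpositions. The second one fixes i, which differs
    from both k and [g1 l]. *)
Lemma exists_bij2 (i k : Y) (j l : X) : #|X| = #|Y| -> i != k -> j != l ->
  exists2 s : X -> Y, bijective s & s j = i /\ s l = k.
Proof.
move=> eqXY ik jl.
pose g x : Y := enum_val (cast_ord eqXY (enum_rank x)).
have inj_g : injective g by move=> x y /enum_val_inj /cast_ord_inj /enum_rank_inj.
pose sw (a b x : Y) := if x == a then b else if x == b then a else x.
have swK a b : involutive (sw a b).
  move=> x; rewrite /sw; case: (eqVneq x a) => [->|xa].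
    by rewrite eqxx; case: eqVneq.
  case: (eqVneq x b) => [->|xb]; first by rewrite eqxx.
  by rewrite (negPf xa) (negPf xb).
pose g1 x := sw (g j) i (g x).
exists (fun x => sw (g1 l) k (g1 x)).
  apply: inj_card_bij; last by rewrite eqXY.
  by move=> x y /(can_inj (swK _ _)) /(can_inj (swK _ _)) /inj_g.
have g1j : g1 j = i by rewrite /g1 /sw eqxx.
split; last by rewrite /sw eqxx.
rewrite g1j /sw -g1j (can_eq (swK _ _)) (inj_eq inj_g) (negPf jl) g1j.
by rewrite (negPf ik).
Qed.

(* The reflection 1 - (2/5) u u^T with u = e_j - 2 e_l: it acts on the plane of
   e_j and e_l by the matrix (3, 4; 4, -3) / 5, without zero entry. *)
Definition plane_reflection (j l : X) : lin C X X :=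
  let u m : C := (m == j)%:R - 2 * (m == l)%:R in
  fun m n => (m == n)%:R - 2 / 5 * u m * u n.

Lemma plane_reflection_sym j l m n :
  plane_reflection j l m n = plane_reflection j l n m.
Proof. by rewrite /plane_reflection eq_sym mulrAC. Qed.

Lemma plane_reflection_real j l m n :
  (plane_reflection j l m n)^* = plane_reflection j l m n.
Proof.
by rewrite /plane_reflection !(conjB, conjM, conjC_nat, conjV).
Qed.

Section Plane.
Variables j l : X.
Hypothesis jl : j != l.
Let R := plane_reflection j l.

(** The factor 2/5 is 2 divided by the squared norm 1 + 4 of u, so R is a real symmetric
    involution. *)
Lemma unitary_plane_reflection : unitary R.
Proof.
have RR : comp R R = @idop C X.
  apply: linP => m n; rewrite /comp /R /plane_reflection /idop.
  set u := fun m : X => (m == j)%:R - 2 * (m == l)%:R : C.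
  have sum_u (f : X -> C) : \sum_x u x * f x = f j - 2 * f l.
    under eq_bigr do rewrite mulrBl -mulrA.
    rewrite sumrB -mulr_sumr; congr (_ - 2 * _); rewrite -[RHS]sum_delta.
      by apply: eq_bigr => x _; rewrite eq_sym.
    by apply: eq_bigr => x _; rewrite eq_sym.
  transitivity (\sum_x ((m == x)%:R * ((x == n)%:R - 2 / 5 * u x * u n)
                 - 2 / 5 * u m * (u x * ((x == n)%:R - 2 / 5 * u x * u n)))).
    by apply: eq_bigr => x _; rewrite /u; ring.
  rewrite sumrB sum_delta -mulr_sumr sum_u.
  have uj : u j = 1 by rewrite /u eqxx (negPf jl) /=; ring.
  have ul : u l = - 2 by rewrite /u eqxx eq_sym (negPf jl) /=; ring.
  rewrite uj ul.
  have -> : u n = (j == n)%:R - 2 * (l == n)%:R by rewrite /u !(eq_sym n).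
  by field.
have aR : adj R = R.
  by apply: linP => m n; rewrite /adj plane_reflection_real plane_reflection_sym.
by apply/unitaryP; rewrite /isometry !aR RR.
Qed.

Lemma plane_reflection_entries :
  [/\ R j j = 3 / 5, R j l = 4 / 5, R l l = - (3 / 5),
      forall n, n != j -> n != l -> R j n = 0 &
      forall n, n != j -> n != l -> R l n = 0].
Proof.
have lj : l != j by rewrite eq_sym.
rewrite /R /plane_reflection !eqxx (negPf jl) (negPf lj).
split; try by rewrite /=; field.
  by move=> n nj nl; rewrite (eq_sym j) (negPf nj) (negPf nl) /=; ring.
by move=> n nj nl; rewrite (eq_sym l) (negPf nj) (negPf nl) /=; ring.
Qed.

(** The entrywise product of rows j and l is 12/25 at j, -12/25 at l and zero elsewhere, so the sum
    is 12/25 (f j - f l). *)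
Lemma plane_reflection_rows (f : X -> C) :
  \sum_n R j n * R l n * f n = 0 -> f j = f l.
Proof.
have [Rjj Rjl Rll Rj Rl] := plane_reflection_entries.
rewrite (bigD1 j) //= (bigD1 l) 1?eq_sym //= big1 => [|n /andP[nj nl]]; last first.
  by rewrite Rj ?mul0r.
rewrite addr0 Rjj Rjl Rll [R l j]plane_reflection_sym -/R Rjl => E.
have -> : f j = f l + 25 / 12 * (3 / 5 * (4 / 5) * f j + 4 / 5 * - (3 / 5) * f l).
  by field.
by rewrite E mulr0 addr0.
Qed.
End Plane.

Variables (b : Y -> X -> Y -> X -> C) (c : C).
Hypothesis eqXY : #|X| = #|Y|.
Hypothesis Hb : forall V : lin C X Y, unitary V ->
  \sum_i \sum_k \sum_j \sum_l (V i j)^* * V k l * b i j k l = c.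

(** V may be replaced by D V D' with D and D' diagonal unitaries. Applying [phase_form] to the
    phases of D and then to those of D' splits the constant sum into these four relations. *)
Lemma twirl_phases (V : lin C X Y) : unitary V ->
  [/\ forall i k j l, i != k -> j != l -> (V i j)^* * V k l * b i j k l = 0,
      forall i k, i != k -> \sum_j (V i j)^* * V k j * b i j k j = 0,
      forall j l, j != l -> \sum_i (V i j)^* * V i l * b i j i l = 0 &
      \sum_j \sum_i (V i j)^* * V i j * b i j i j = c].
Proof.
move=> uV; pose a i j k l := (V i j)^* * V k l * b i j k l.
have step1 d' : phases d' ->
    (forall i k, i != k -> \sum_j \sum_l (d' j)^* * d' l * a i j k l = 0) /\
    \sum_i \sum_j \sum_l (d' j)^* * d' l * a i j i l = c.
  move=> d1'; apply: (@phase_form C Y (fun i k =>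
    \sum_j \sum_l (d' j)^* * d' l * a i j k l)) => d d1.
  rewrite -(Hb (unitary_phases uV d1 d1')).
  apply: eq_bigr => i _; apply: eq_bigr => k _; rewrite mulr_sumr.
  apply: eq_bigr => j _; rewrite mulr_sumr; apply: eq_bigr => l _.
  by rewrite /a !conjM; ring.
have step2 i k : i != k -> (forall j l, j != l -> a i j k l = 0) /\
    \sum_j a i j k j = 0.
  move=> ik; apply: (@phase_form C X (fun j l => a i j k l)) => d' d1'.
  by have [H _] := step1 _ d1'; apply: H.
have step3 : (forall j l, j != l -> \sum_i a i j i l = 0) /\
    \sum_j \sum_i a i j i j = c.
  apply: (@phase_form C X (fun j l => \sum_i a i j i l)) => d' d1'.
  have [_ <-] := step1 _ d1'; rewrite [RHS]exchange_big; apply: eq_bigr => j _.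
  rewrite exchange_big; apply: eq_bigr => l _.
  by rewrite mulr_sumr.
split; [|by move=> i k /step2[]|by case: step3|by case: step3].
by move=> i k j l /step2[H _]; apply: H.
Qed.

(** This is the last relation of [twirl_phases] for the permutation matrix of s. *)
Lemma twirl_perm (s : X -> Y) : bijective s -> \sum_j b (s j) j (s j) j = c.
Proof.
case=> t st ts.
have bt : bijective t by exists s.
have [_ _ _ <-] := twirl_phases (unitary_perm C bt).
apply: eq_bigr => j _; rewrite (bigD1 (s j)) //= st eqxx conjC_nat !mul1r.
rewrite big1 ?addr0 // => i.
by rewrite -(can_eq ts) st => /negPf->; rewrite mulr0 mul0r.
Qed.

(** V is taken to be the plane reflection followed by a bijection sending j to i and l to k. Its
    four entries in rows i, k and columns j, l are nonzero, and these rows and columns vanish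
    elsewhere. *)
Lemma twirl_plane i k j l : i != k -> j != l ->
  [/\ b i j k l = 0, b i j k j = b i l k l & b i j i l = b k j k l].
Proof.
move=> ik jl; have [s [t st ts] [<- <-]] := exists_bij2 eqXY ik jl.
have bt : bijective t by exists s.
have bid : bijective (@id X) by exists id.
have jl' : s j != s l by rewrite (can_eq st).
have [H1 H2 H3 _] :=
  twirl_phases (unitary_reindex bid bt (unitary_plane_reflection jl)).
have [Rjj Rjl Rll _ _] := plane_reflection_entries jl.
split.
- have /eqP := H1 _ _ _ _ jl' jl; rewrite !st Rjj Rll.
  rewrite !mulf_eq0 conjC_eq0 oppr_eq0 !mulf_eq0 !invr_eq0 !pnatr_eq0 /=.
  by move=> /eqP.
- apply: (plane_reflection_rows jl (f := fun n => b (s j) n (s l) n)).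
  rewrite -[RHS](H2 _ _ jl'); apply: eq_bigr => n _.
  by rewrite !st plane_reflection_real.
- apply: (plane_reflection_rows jl (f := fun n => b (s n) j (s n) l)).
  rewrite -[RHS](H3 _ _ jl) [RHS](reindex s) /=; last by apply: onW_bij; exists t.
  apply: eq_bigr => n _; rewrite !st plane_reflection_real.
  by rewrite !(plane_reflection_sym _ _ n).
Qed.
End Twirl.

(** * Linear maps preserving unitarity *)

Section UnitaryPreserver.
Variable C : numClosedFieldType.
Variables X Y P F : finType.
Variable g : Y -> X -> lin C P F.

Definition contract (V : lin C X Y) : lin C P F :=
  fun f p => \sum_i \sum_j V i j * g i j f p.

Hypothesis eqXY : #|X| = #|Y|.
Hypothesis Hg : forall V, unitary V -> unitary (contract V).

Lemma comp_contract_adj V p p' :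
  comp (adj (contract V)) (contract V) p p' =
  \sum_i \sum_k \sum_j \sum_l
    (V i j)^* * V k l * comp (adj (g i j)) (g k l) p p'.
Proof.
rewrite /comp /adj /contract.
under eq_bigr => f _.
  rewrite conj_sum big_distrlr /=.
  under eq_bigr => i _. under eq_bigr => k _.
    rewrite conj_sum big_distrlr /=.
    under eq_bigr => j _. under eq_bigr => l _ do rewrite conjM mulrACA.
    over. over. over. over.
rewrite exchange_big; apply: eq_bigr => i _.
rewrite exchange_big; apply: eq_bigr => k _.
rewrite exchange_big; apply: eq_bigr => j _.
rewrite exchange_big; apply: eq_bigr => l _.
by rewrite mulr_sumr.
Qed.

(** The sum is arranged with the coefficients of [comp_contract_adj], so that the same relations for
    constant forms apply to products in either order. *)
Lemma comp_contract_adjr V f f' :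
  comp (contract V) (adj (contract V)) f f' =
  \sum_i \sum_k \sum_j \sum_l
    (V i j)^* * V k l * comp (g k l) (adj (g i j)) f f'.
Proof.
rewrite /comp /adj /contract.
under eq_bigr => p _.
  rewrite mulrC conj_sum big_distrlr /=.
  under eq_bigr => i _. under eq_bigr => k _.
    rewrite conj_sum big_distrlr /=.
    under eq_bigr => j _. under eq_bigr => l _.
    rewrite conjM mulrACA [X in _ * X]mulrC.
    over. over. over. over. over.
rewrite exchange_big; apply: eq_bigr => i _.
rewrite exchange_big; apply: eq_bigr => k _.
rewrite exchange_big; apply: eq_bigr => j _.
rewrite exchange_big; apply: eq_bigr => l _.
by rewrite mulr_sumr.
Qed.

(** As for partial isometries, [initial] refers to products [adj g] g on P and [final] to products g
    [adj g] on F. *)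
Lemma contract_initial V p p' : unitary V ->
  \sum_i \sum_k \sum_j \sum_l
    (V i j)^* * V k l * comp (adj (g i j)) (g k l) p p' = (p == p')%:R.
Proof. by move=> /Hg[uV _]; rewrite -comp_contract_adj uV. Qed.

Lemma contract_final V f f' : unitary V ->
  \sum_i \sum_k \sum_j \sum_l
    (V i j)^* * V k l * comp (g k l) (adj (g i j)) f f' = (f == f')%:R.
Proof. by move=> /Hg[_ uV]; rewrite -comp_contract_adjr uV. Qed.

Lemma unit_plane_initial i k j l : i != k -> j != l ->
  [/\ comp (adj (g i j)) (g k l) = @zop C P P,
      comp (adj (g i j)) (g k j) = comp (adj (g i l)) (g k l) &
      comp (adj (g i j)) (g i l) = comp (adj (g k j)) (g k l)].
Proof.
move=> ik jl; split; apply: linP => p p';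
  by have [] := twirl_plane (b := fun i j k l => comp (adj (g i j)) (g k l) p p')
    eqXY (fun V => contract_initial (V:=V) p p') ik jl.
Qed.

Lemma unit_plane_final i k j l : i != k -> j != l ->
  comp (g i j) (adj (g k l)) = @zop C F F /\
  comp (g i j) (adj (g i l)) = comp (g k j) (adj (g k l)).
Proof.
move=> ik jl; have ki : k != i by rewrite eq_sym.
have lj : l != j by rewrite eq_sym.
pose b f f' i j k l := comp (g k l) (adj (g i j)) f f'.
have H f f' := twirl_plane (b := b f f') eqXY
  (fun V => contract_final (V:=V) f f').
(* In [b] the second index pair stands on the left, hence the exchanged pairs. *)
split; apply: linP => f f'; first by have [] := H f f' _ _ _ _ ki lj.
by have [] := H f f' _ _ _ _ ik lj.
Qed.

Lemma unit_perm_initial (s : X -> Y) p p' : bijective s ->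
  \sum_j comp (adj (g (s j) j)) (g (s j) j) p p' = (p == p')%:R.
Proof.
exact: (twirl_perm (b := fun i j k l => comp (adj (g i j)) (g k l) p p')
  (fun V => contract_initial (V:=V) p p')).
Qed.

(** Along a permutation the initial operators sum to the identity; if K kills all but one of them,
    it is fixed by the remaining one. *)
Lemma comp_perm_initial (s : X -> Y) T (K : lin C P T) j : bijective s ->
  (forall m, m != j -> comp K (comp (adj (g (s m) m)) (g (s m) m)) = @zop C P T) ->
  comp K (comp (adj (g (s j) j)) (g (s j) j)) = K.
Proof.
move=> bs K0; rewrite -[RHS]compo1; apply: linP => t p.
transitivity (\sum_m comp K (comp (adj (g (s m) m)) (g (s m) m)) t p).
  by rewrite (bigD1 j) //= big1 ?addr0 // => m /K0->.
rewrite /comp exchange_big; apply: eq_bigr => p' _.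
by rewrite -mulr_sumr unit_perm_initial.
Qed.

Lemma exists_neq (i k : Y) (j : X) : i != k -> exists l : X, j != l.
Proof.
move=> ik; have : (1 < #|Y|)%N by apply/card_gt1P; exists i, k.
rewrite -eqXY => /card_gt1P[l1 [l2 [_ _ l12]]].
by case: (eqVneq j l1) => [->|]; [exists l2|exists l1].
Qed.

(** The other units of a permutation through (i, j) lie in another row and another column, so g_ij
    kills their initial operators by [unit_plane_final]. *)
Lemma unit_partial_isometry i k j : i != k ->
  comp (g i j) (comp (adj (g i j)) (g i j)) = g i j.
Proof.
move=> ik; have [l jl] := exists_neq j ik.
have [s bs [<- sl]] := exists_bij2 eqXY ik jl.
apply: comp_perm_initial => // m mj.
rewrite compA (unit_plane_final _ _).1 ?comp0o // 1?eq_sym //.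
by rewrite (inj_eq (bij_inj bs)).
Qed.

(* A unitary-preserving g is, up to fixed unitaries, V |-> V (x) 1 (+) V^T (x) 1;
   the overlap of two matrix units of the same column is nonzero exactly on the
   transposed summand. *)
Lemma overlap_partial_isometry i k j : i != k ->
  let M := comp (adj (g i j)) (g k j) in comp M (comp (adj M) M) = M.
Proof.
move=> ik M; have [l jl] := exists_neq j ik.
have ki : k != i by rewrite eq_sym.
(* The right-hand side is an operator times its adjoint, hence self-adjoint, so the two final
   projections commute. *)
have E : comp (comp (g i j) (adj (g i j))) (comp (g k j) (adj (g k j))) =
         comp (comp (g i j) (adj (g i l))) (comp (g i l) (adj (g i j))).
  have [_ H1 _] := unit_plane_initial ik jl.
  rewrite (unit_plane_final ik (_ : l != j)).2 1?eq_sym //.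
  by rewrite -!compA [in LHS](compA (adj (g i j))) H1 !compA.
have swapE : comp (comp (g k j) (adj (g k j))) (comp (g i j) (adj (g i j))) =
             comp (comp (g i j) (adj (g i j))) (comp (g k j) (adj (g k j))).
  have := congr1 (@adj _ _ _) E; rewrite !adj_comp !adjK => ->.
  by rewrite E -!compA.
have aM : adj M = comp (adj (g k j)) (g i j) by rewrite /M adj_comp adjK.
transitivity (comp (adj (g i j)) (comp (comp (comp (g k j) (adj (g k j)))
   (comp (g i j) (adj (g i j)))) (g k j))).
  by rewrite aM /M -!compA.
rewrite swapE.
transitivity (comp (comp (adj (g i j)) (comp (g i j) (adj (g i j))))
  (comp (g k j) (comp (adj (g k j)) (g k j)))).
  by rewrite -!compA.
rewrite (unit_partial_isometry j ki).
have := congr1 (@adj _ _ _) (unit_partial_isometry j ik).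
by rewrite !adj_comp adjK -compA => ->.
Qed.

Hypothesis overlap0 : forall i k j, i != k -> comp (adj (g i j)) (g k j) = @zop C P P.

Lemma gram_offdiag i k j l : i != k -> comp (adj (g i j)) (g k l) = @zop C P P.
Proof.
move=> ik; case: (eqVneq j l) => [->|jl]; first exact: overlap0.
by have [] := unit_plane_initial ik jl.
Qed.

(** Apply [comp_perm_initial] to the initial operator of g_kj, along a permutation that sends j to
    i. *)
Lemma gram_diag_absorb i k j : i != k ->
  comp (comp (adj (g k j)) (g k j)) (comp (adj (g i j)) (g i j)) =
  comp (adj (g k j)) (g k j).
Proof.
move=> ik; have ki : k != i by rewrite eq_sym.
have [l jl] := exists_neq j ik.
have [s bs [sj _]] := exists_bij2 eqXY ik jl.
rewrite -sj; apply: comp_perm_initial => // m; rewrite eq_sym => jm.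
rewrite -!compA (compA (g k j)); case: (eqVneq (s m) k) => [->|smk].
  (* In row k the final product g_kj [adj g_km] equals g_ij [adj g_im], and [adj g_kj] g_ij is a
     vanishing overlap. *)
  by rewrite -(unit_plane_final ik jm).2 !compA overlap0 // !comp0o.
rewrite eq_sym in smk.
by rewrite (unit_plane_final smk jm).1 comp0o compo0.
Qed.

(** For j = l, write G_i and G_k for the two self-adjoint operators. Absorption gives G_k G_i = G_k,
    and the adjoint of G_i G_k = G_i gives G_k G_i = G_i. *)
Lemma gram_diag i k j l :
  comp (adj (g i j)) (g i l) = comp (adj (g k j)) (g k l).
Proof.
case: (eqVneq i k) => [->//|ik]; have ki : k != i by rewrite eq_sym.
case: (eqVneq j l) => [<-|jl]; last by have [] := unit_plane_initial ik jl.
rewrite -(gram_diag_absorb j ik) -[LHS](gram_diag_absorb j ki).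
have := congr1 (@adj _ _ _) (gram_diag_absorb j ki); rewrite !adj_comp !adjK => ->.
by rewrite gram_diag_absorb.
Qed.
End UnitaryPreserver.

(** * Circles of unitaries *)

Section Path.
Variable C : numClosedFieldType.

(** The Cayley transforms (1 + n i) / (1 - n i) of the natural numbers are infinitely many points of
    the circle. *)
Lemma circle_poly_eq0 (p : {poly C}) :
  (forall z : C, z^* * z = 1 -> p.[z] = 0) -> p = 0.
Proof.
move=> p0; pose u n : C := 1 + n%:R * 'i; pose v n : C := 1 - n%:R * 'i.
have uv n : u n * v n = 1 + n%:R ^+ 2.
  rewrite /u /v; transitivity (1 - n%:R ^+ 2 * 'i ^+ 2 : C); first by ring.
  by rewrite sqrCi; ring.
have uv0 n : u n * v n != 0.
  by rewrite uv gt_eqF // ltr_wpDr ?ltr01 // exprn_ge0 ?ler0n.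
have v0 n : v n != 0 by apply: contraNneq (uv0 n) => ->; rewrite mulr0.
have u0 n : u n != 0 by apply: contraNneq (uv0 n) => ->; rewrite mul0r.
pose z n := u n / v n.
have z1 n : (z n)^* * z n = 1.
  have cu : (u n)^* = v n by rewrite /u /v conjD conjM conjC1 conjC_nat conjCi mulrN.
  have cv : (v n)^* = u n by rewrite -cu conjCK.
  by rewrite /z conjM conjV cu cv; field; rewrite u0 v0.
have inj_z : injective z.
  move=> m n /eqP; rewrite /z eqr_div // -subr_eq0.
  have -> : u m * v n - u n * v m = 2 * 'i * (m%:R - n%:R) by rewrite /u /v; ring.
  rewrite !mulf_eq0 pnatr_eq0 (negPf (neq0Ci C)) /= subr_eq0 eqr_nat.
  by move/eqP.
apply: (@roots_geq_poly_eq0 _ p [seq z n | n <- iota 0 (size p)]).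
- by apply/allP => _ /mapP[n _ ->]; apply/rootP/p0.
- by rewrite map_inj_uniq ?iota_uniq.
- by rewrite size_map size_iota.
Qed.

Variables P F : finType.
Implicit Types a b : lin C P F.

Definition affine a b (z : C) : lin C P F := fun f p => a f p + z * b f p.

(** On the unit circle conj(z) = 1/z, so an extra factor z turns conj(a + z b) into the polynomial
    conj(a) z + conj(b). *)
Let pol a b a' b' p p' : {poly C} :=
  \sum_f ((a f p)^* *: 'X + (b f p)^*%:P) * ((a' f p')%:P + b' f p' *: 'X).

Lemma pol_horner a b a' b' p p' z : z^* * z = 1 ->
  (pol a b a' b' p p').[z] = z * comp (adj (affine a b z)) (affine a' b' z) p p'.
Proof.
move=> z1; rewrite /pol horner_sum /comp mulr_sumr; apply: eq_bigr => f _.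
rewrite hornerM !hornerD !hornerZ !hornerC hornerX.
rewrite /adj /affine conjD conjM mulrA.
congr (_ * _); last by ring.
transitivity (z * (a f p)^* + (z^* * z) * (b f p)^*); last by ring.
by rewrite z1; ring.
Qed.

(* Multiplied by z, the overlap M and its adjoint become matrices N and N' of
   polynomials in z with N N' N = z^2 N.  As z - 1 divides N', every power of z - 1
   divides N. *)
Lemma affine_overlap0 a b a' b' :
  let M z := comp (adj (affine a b z)) (affine a' b' z) in
  (forall z, z^* * z = 1 -> comp (M z) (comp (adj (M z)) (M z)) = M z) ->
  M 1 = @zop C P P -> forall z, z^* * z = 1 -> M z = @zop C P P.
Proof.
move=> M HM M1 z z1.
have one1 : (1 : C)^* * 1 = 1 by rewrite conjC1 mulr1.
pose N := pol a b a' b'; pose N' := pol a' b' a b.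
have aM y : adj (M y) = comp (adj (affine a' b' y)) (affine a b y).
  by rewrite /M adj_comp adjK.
have NE y p p' : y^* * y = 1 -> (N p p').[y] = y * M y p p'.
  exact: pol_horner.
have N'E y p p' : y^* * y = 1 -> (N' p p').[y] = y * adj (M y) p p'.
  by rewrite aM; apply: pol_horner.
have cubic p p' : 'X^2 * N p p' = \sum_q (\sum_r N p q * (N' q r * N r p')).
  apply/eqP; rewrite -subr_eq0; apply/eqP/circle_poly_eq0 => y y1.
  rewrite hornerD hornerN hornerM hornerXn NE // -[in M y p p'](HM y) // /comp.
  rewrite horner_sum !mulr_sumr; apply/eqP; rewrite subr_eq0; apply/eqP.
  apply: eq_bigr => q _; rewrite horner_sum !mulr_sumr; apply: eq_bigr => r _.
  by rewrite !hornerM !NE // N'E //; ring.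
have div1 (p : {poly C}) : p.[1] = 0 -> ('X - 1%:P) %| p.
  by move=> p1; rewrite dvdp_XsubCl; apply/rootP.
have N'1 p p' : ('X - 1%:P) %| N' p p'.
  by apply: div1; rewrite N'E // /adj M1 conjC0 mulr0.
have divN n p p' : ('X - 1%:P) ^+ n %| N p p'.
  elim: n p p' => [|n IHn] p p'; first by rewrite expr0 dvd1p.
  (* As X - 1 is coprime to X, it is enough to divide X^2 N, which is the cubic expression. *)
  rewrite -(@Gauss_dvdpr _ _ ('X^2)); last first.
    rewrite coprimep_pexpl // coprimep_pexpr // coprimepX root_XsubC.
    by rewrite eq_sym oner_eq0.
  rewrite cubic; apply: (big_ind (fun r => _ %| r)) => [|x y|q _]; [exact: dvdp0|exact: dvdp_add|].
  apply: (big_ind (fun r => _ %| r)) => [|x y|r _]; [exact: dvdp0|exact: dvdp_add|].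
  (* One factor X - 1 comes from N', the other n from the last N. *)
  by rewrite dvdp_mull // exprS dvdp_mul.
have N0 p p' : N p p' = 0.
  apply/eqP; apply: contraT => Np.
  have := dvdp_leq Np (divN (size (N p p')) p p').
  by rewrite size_exp_XsubC ltnn.
apply: linP => p p'; have := NE z p p' z1; rewrite N0 horner0 => /esym/eqP.
rewrite mulf_eq0 => /orP[/eqP z0|/eqP//].
by have /eqP := z1; rewrite z0 mulr0 eq_sym oner_eq0.
Qed.
End Path.

(** * Spectral decomposition of unitary and of positive operators *)

Section Spectral.
Variable C : numClosedFieldType.
Variable X : finType.
Implicit Types (K S U : lin C X X) (d e : X -> C).

Definition conj_diag S d : lin C X X :=
  fun y x => \sum_k (S k y)^* * (d k * S k x).

Lemma conj_diagE S d :
  conj_diag S d = comp (adj S) (comp (fun k l => d k * (k == l)%:R) S).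
Proof.
apply: linP => y x; apply: eq_bigr => k _; congr (_ * _).
rewrite /comp -[LHS](@sum_delta _ _ k (fun z => d k * S z x)).
by apply: eq_bigr => z _; ring.
Qed.

Local Open Scope sesquilinear_scope.

Lemma spectral_decomposition K : comp K (adj K) = comp (adj K) K ->
  exists S d, unitary S /\ K = conj_diag S d.
Proof.
move=> normK; pose A := mx_of K.
have mx_adj L : mx_of (adj L) = (mx_of L)^t*.
  by apply/matrixP => i j; rewrite !mxE.
have /orthomx_spectralP : A \is normalmx.
  by apply/normalmxP; rewrite -mx_adj -!mx_of_comp normK.
have := spectral_unitarymx A.
move: (spectralmx A) (spectral_diag A) => B sp uB EA.
pose S : lin C X X := fun y x => B (enum_rank y) (enum_rank x).
have mxS : mx_of S = B by apply/matrixP => i j; rewrite !mxE /S !enum_valK.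
exists S, (fun k => sp 0 (enum_rank k)); split.
  rewrite -[S]adjK; apply: unitary_adj; apply: isometry_square_unitary => //.
  rewrite /isometry adjK; apply: mx_of_inj.
  by rewrite mx_of_comp mx_adj mxS mx_of_id; apply/unitarymxP.
rewrite conj_diagE; apply: mx_of_inj.
rewrite !mx_of_comp mx_adj mxS -invmx_unitary // mulmxA -/A {1}EA.
congr (_ *m _ *m _); apply/matrixP => i j; rewrite !mxE enum_valK.
by rewrite (inj_eq enum_val_inj) mulr_natr.
Qed.

Lemma conj_diag_entry S d k : unitary S ->
  comp S (comp (conj_diag S d) (adj S)) k k = d k.
Proof.
case/unitaryP; rewrite /isometry adjK conj_diagE => _ S1.
by rewrite -!compA S1 compo1 !compA S1 comp1o eqxx mulr1.
Qed.

Lemma conj_diag_unitary S d : unitary S -> phases d -> unitary (conj_diag S d).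
Proof.
move=> uS d1; rewrite conj_diagE; apply: unitary_comp (unitary_adj uS) _.
exact: unitary_comp (unitary_diag d1) uS.
Qed.

Lemma conj_diag_phases S d : unitary S -> unitary (conj_diag S d) -> phases d.
Proof.
move=> uS uD k.
have := unitary_comp uS (unitary_comp uD (unitary_adj uS)).
have -> : comp S (comp (conj_diag S d) (adj S)) = fun k l => d k * (k == l)%:R.
  case/unitaryP: uS; rewrite /isometry adjK conj_diagE => _ S1.
  by rewrite -!compA S1 compo1 !compA S1 comp1o.
move=> [U1 _]; have := U1 k k; rewrite /idop eqxx /comp => U1k; apply: etrans U1k.
rewrite (bigD1 k) //= big1 ?addr0 => [|l lk]; first by rewrite /adj eqxx mulr1.
by rewrite /adj (negPf lk) mulr0 conjC0 mul0r.
Qed.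

(** Turning one eigenvalue along the unit circle is thus an affine circle of operators. *)
Lemma conj_diag_affine S e k z :
  affine (conj_diag S (fun l => if l == k then 0 else e l))
    (conj_diag S (fun l => (l == k)%:R)) z =
  conj_diag S (fun l => if l == k then z else e l).
Proof.
apply: linP => y x; rewrite /affine /conj_diag mulr_sumr -big_split /=.
by apply: eq_bigr => l _; case: (l == k) => /=; ring.
Qed.

(* Move from 1 to U by changing one eigenvalue at a time, each along the unit circle. *)
Lemma unitary_ind (Q : lin C X X -> Prop) :
  Q (@idop C X) ->
  (forall a b, (forall z : C, z^* * z = 1 -> unitary (affine a b z)) ->
     Q (affine a b 1) -> forall z : C, z^* * z = 1 -> Q (affine a b z)) ->
  forall U, unitary U -> Q U.
Proof.
move=> Q1 Qstep U uU.
have [S [d [uS defU]]] : exists S d, unitary S /\ U = conj_diag S d.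
  apply: spectral_decomposition; have [uU1] := iffLR (unitaryP _) uU.
  by rewrite /isometry adjK uU1 => ->.
have d1 : phases d by apply: conj_diag_phases uS _; rewrite -defU.
(* The eigenvalues indexed by s already have their final value; the others are still 1. *)
pose e (s : seq X) k := if k \in s then d k else 1.
suff Qe s : Q (conj_diag S (e s)).
  rewrite defU -[d](_ : e (enum X) = d) //.
  by apply: functional_extensionality => k; rewrite /e mem_enum.
elim: s => [|k s IHs].
  suff -> : conj_diag S (e [::]) = @idop C X by [].
  rewrite -(proj1 (iffLR (unitaryP _) uS)); apply: linP => y x.
  by apply: eq_bigr => l _; rewrite mul1r.
case: (boolP (k \in s)) => [ks|ks].
  suff -> : e (k :: s) = e s by [].
  apply: functional_extensionality => l; rewrite /e inE.
  by case: eqP => // ->; rewrite ks.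
have E z : affine _ _ z = _ := conj_diag_affine S (e s) k z.
have es1 : phases (e s) by move=> l; rewrite /e; case: ifP => _; [exact: d1|exact: phases1 l].
(* As k is not in s, its eigenvalue is still 1, and setting it to z is a multiplication by z. *)
have ezE z : (fun l => if l == k then z else e s l) =
  (fun l => if l == k then z * e s l else e s l).
  apply: functional_extensionality => l.
  by case: eqP => // ->; rewrite /e (negPf ks) mulr1.
have -> : e (k :: s) = fun l => if l == k then d k else e s l.
  by apply: functional_extensionality => l; rewrite /e inE; case: eqP => [->|] /=.
rewrite -E; apply: Qstep (d1 k) => [z z1|].
  by rewrite E ezE; apply: conj_diag_unitary => //; apply: phases_update.
rewrite E; suff <- : e s = fun l => if l == k then 1 else e s l by [].
apply: functional_extensionality => l.
by case: eqP => // ->; rewrite /e (negPf ks).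
Qed.

(** Polarization: the form is real at v, w and v + z w, so z q(v, w) + conj(z) q(w, v) is real. The
    choices z = 1 and z = ['i] give conj q(v, w) = q(w, v). *)
Lemma psd_hermitian K : psd K -> adj K = K.
Proof.
move=> psdK; pose q (v w : vec C X) := \sum_t \sum_t' (v t)^* * K t t' * w t'.
have qlin (v w : vec C X) (z : C) : q (fun t => v t + z * w t) (fun t => v t + z * w t) =
    q v v + z^* * z * q w w + (z * q v w + z^* * q w v).
  rewrite /q !mulr_sumr -!big_split; apply: eq_bigr => t _ /=.
  rewrite !mulr_sumr -!big_split; apply: eq_bigr => t' _ /=.
  by rewrite conjD conjM; ring.
have qreal (v w : vec C X) (z : C) : (z * q v w + z^* * q w v)^* = z * q v w + z^* * q w v.
  have Q v' : (q v' v')^* = q v' v' by apply/CrealP/ger0_real; apply: psdK.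
  have := Q (fun t => v t + z * w t); rewrite qlin conjD [X in X + _]conjD !conjM !Q conjCK.
  by rewrite [z * z^*]mulrC => /addrI.
have qE x y : q (fun t => (t == x)%:R) (fun t => (t == y)%:R) = K x y.
  rewrite /q (bigD1 x) //= [X in _ + X]big1 ?addr0 => [|t /negPf->].
    rewrite (bigD1 y) //= big1 ?addr0 => [|t /negPf->]; last by rewrite mulr0.
    by rewrite !eqxx conjC1 mulr1 mul1r.
  by apply: big1 => t' _; rewrite conjC0 !mul0r.
apply: linP => x y; rewrite /adj -!qE.
set a := q _ _; set b := q _ _.
have := qreal (fun t => (t == y)%:R) (fun t => (t == x)%:R) 1.
have := qreal (fun t => (t == y)%:R) (fun t => (t == x)%:R) 'i.
rewrite -/a -/b !conjD !conjM !conjCK !conjC1 conjCi !mul1r => Ei E1.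
have ii : 'i * 'i = -1 :> C by rewrite -expr2 sqrCi.
have -> : a^* = ((a^* + b^*) - ('i * 'i) * (a^* - b^*)) / 2 by rewrite ii; field.
have -> : ('i * 'i) * (a^* - b^*) = - ('i * (- 'i * a^* + 'i * b^*)) by ring.
rewrite Ei E1.
have -> : 'i * ('i * a + - 'i * b) = 'i * 'i * (a - b) by ring.
by rewrite ii; field.
Qed.

Lemma psd_decomposition K : psd K ->
  exists v : X -> vec C X, forall t t', K t t' = \sum_k v k t * (v k t')^*.
Proof.
move=> psdK; have [|S [d [uS defK]]] := @spectral_decomposition K.
  by rewrite psd_hermitian.
(* An eigenvalue is the value of the form at its eigenvector, the conjugate of row k of S. *)
have d0 k : 0 <= d k.
  rewrite -(conj_diag_entry d k uS) -defK.
  have := psdK (fun t => (S k t)^*); congr (_ <= _).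
  rewrite /comp; apply: eq_bigr => t _; rewrite mulr_sumr.
  by apply: eq_bigr => t' _; rewrite conjCK /adj mulrA.
exists (fun k t => sqrtC (d k) * (S k t)^*) => t t'.
rewrite defK; apply: eq_bigr => k _; rewrite conjM conjCK.
have cs : (sqrtC (d k))^* = sqrtC (d k).
  by apply/CrealP/ger0_real; rewrite sqrtC_ge0.
by rewrite cs -[d k in LHS]sqrtCK; ring.
Qed.
End Spectral.

(** * Tensor products and dilation *)

Section Tensor.
Variable C : numClosedFieldType.

Lemma sum_pair (A B : finType) (f : A * B -> C) :
  \sum_z f z = \sum_a \sum_b f (a, b).
Proof. by rewrite pair_bigA; apply: eq_bigr => -[]. Qed.

Lemma comp_tensor (X1 Y1 Z1 X2 Y2 Z2 : finType) (K : lin C Y1 Z1) (L : lin C X1 Y1)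
    (K' : lin C Y2 Z2) (L' : lin C X2 Y2) :
  comp (tensor K K') (tensor L L') = tensor (comp K L) (comp K' L').
Proof.
apply: linP => z x; rewrite /comp /tensor big_distrlr sum_pair /=.
by apply: eq_bigr => y1 _; apply: eq_bigr => y2 _; rewrite mulrACA.
Qed.

Lemma adj_tensor (X1 Y1 X2 Y2 : finType) (K : lin C X1 Y1) (L : lin C X2 Y2) :
  adj (tensor K L) = tensor (adj K) (adj L).
Proof. by apply: linP => y x; rewrite /adj conjM. Qed.

Lemma tensor0 (X1 Y1 X2 Y2 : finType) (L : lin C X2 Y2) :
  tensor (@zop C X1 Y1) L = @zop C (X1 * X2)%type (Y1 * Y2)%type.
Proof. by apply: linP => y x; rewrite /tensor /zop mul0r. Qed.

Lemma comp_tensor_idl (X Y Z Q : finType) (K : lin C Y Z) (M : lin C X (Y * Q)) z x :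
  comp (tensor K (@idop C Q)) M z x = \sum_y K z.1 y * M (y, z.2) x.
Proof.
rewrite /comp /tensor /idop sum_pair; apply: eq_bigr => y _ /=.
by under eq_bigr do rewrite [K _ _ * _]mulrC -mulrA; rewrite sum_delta.
Qed.

Lemma comp_tensor_idr (X Y Z Q : finType) (K : lin C X Y) (M : lin C (Y * Q) Z) z x :
  comp M (tensor K (@idop C Q)) z x = \sum_y M z (y, x.2) * K y x.1.
Proof.
rewrite /comp /tensor /idop sum_pair; apply: eq_bigr => y _ /=.
by under eq_bigr do rewrite mulrA; rewrite sum_deltar.
Qed.

Lemma eq_card_bij (X Y : finType) : #|X| = #|Y| ->
  exists (h : X -> Y) (h' : Y -> X), cancel h h' /\ cancel h' h.
Proof.
move=> eqXY.
exists (fun x => enum_val (cast_ord eqXY (enum_rank x))).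
exists (fun y => enum_val (cast_ord (esym eqXY) (enum_rank y))).
by split=> x; rewrite enum_valK ?cast_ordK ?cast_ordKV enum_rankK.
Qed.
End Tensor.

Section Dilation.
Variable C : numClosedFieldType.

(** The Halmos (Julia) dilation, up to the order and signs of the blocks; the zero block is the
    defect 1 - [adj K] K of an isometry. *)
Definition julia (X Y : finType) (K : lin C X Y) : lin C (X + Y) (X + Y) :=
  fun y x => match y, x with
  | inl _, inl _ => 0
  | inl a, inr c => adj K a c
  | inr c, inl a => K c a
  | inr c, inr c' => (c == c')%:R - comp K (adj K) c c'
  end.

(** The corner R = 1 - K [adj K] is a projection with R K = 0, so the dilation is a self-adjoint
    involution. *)
Lemma unitary_julia (X Y : finType) (K : lin C X Y) : isometry K -> unitary (julia K).
Proof.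
move=> isoK; pose R : lin C Y Y := fun c c' => (c == c')%:R - comp K (adj K) c c'.
have RL T (L : lin C T Y) c t : comp R L c t = L c t - comp (comp K (adj K)) L c t.
  rewrite /comp /R; under eq_bigr do rewrite mulrBl.
  by rewrite sumrB sum_delta.
have RK : comp R K = @zop C X Y.
  by apply: linP => c a; rewrite RL -compA isoK compo1 subrr.
have aR : adj R = R.
  apply: linP => c c'; rewrite /adj /R conjB conjC_nat eq_sym; congr (_ - _).
  by rewrite -[LHS]/(adj (comp K (adj K)) c c') adj_comp adjK.
have RR : comp R R = R.
  apply: linP => c c'; rewrite RL -compA -{2}aR -adj_comp RK adj0 compo0.
  by rewrite subr0.
have aJ : adj (julia K) = julia K.
  apply: linP => -[a|c] [a'|c']; rewrite /adj /= ?conjC0 ?conjCK //.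
  by rewrite -[LHS]/(adj R c c') aR.
have JJ : comp (julia K) (julia K) = @idop C (X + Y)%type.
  apply: linP => y x; rewrite /comp big_sumType /=.
  case: y x => [a|c] [a'|c'] /=.
  - by rewrite big1 ?add0r => [|b _]; [exact: (isometryE isoK)|rewrite mul0r].
  - rewrite big1 ?add0r => [|b _]; last by rewrite mul0r.
    rewrite -[LHS]/(comp (adj K) R a c') -aR -adj_comp RK.
    by rewrite adj0.
  - rewrite big1 ?add0r => [|b _]; last by rewrite mulr0.
    by rewrite -[LHS]/(comp R K c a') RK.
  - rewrite -[X in _ + X]/(comp R R c c') -[X in X + _]/(comp K (adj K) c c') RR.
    by rewrite /R addrC subrK.
by apply/unitaryP; rewrite /isometry !aJ JJ.
Qed.

Variables AI AO Q1 Q2 : finType.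

(* In the dilation the direct sum of AI * Q1 and AO * Q2 is read as AI * (Q1 + Q2)
   on the input side and as AO * (Q1 + Q2) on the output side. *)
Lemma isometry_dilation (K : lin C (AI * Q1) (AO * Q2)) :
  #|AI| = #|AO| -> isometry K ->
  exists U : lin C (AI * (Q1 + Q2)) (AO * (Q1 + Q2)),
    [/\ unitary U,
        forall ao q' ai q, U (ao, inr q') (ai, inl q) = K (ao, q') (ai, q) &
        forall ao q' ai q, U (ao, inl q') (ai, inl q) = 0].
Proof.
move=> eqA isoK; have [h [h' [hK h'K]]] := eq_card_bij eqA.
pose h1 (x : AI * (Q1 + Q2)) : (AI * Q1) + (AO * Q2) :=
  match x.2 with inl q => inl (x.1, q) | inr q => inr (h x.1, q) end.
pose h1' (y : (AI * Q1) + (AO * Q2)) : AI * (Q1 + Q2) :=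
  match y with inl x => (x.1, inl x.2) | inr x => (h' x.1, inr x.2) end.
pose h2 (x : AO * (Q1 + Q2)) : (AI * Q1) + (AO * Q2) :=
  match x.2 with inl q => inl (h' x.1, q) | inr q => inr (x.1, q) end.
pose h2' (y : (AI * Q1) + (AO * Q2)) : AO * (Q1 + Q2) :=
  match y with inl x => (h x.1, inl x.2) | inr x => (x.1, inr x.2) end.
exists (fun y x => julia K (h2 y) (h1 x)); split=> //.
apply: unitary_reindex (unitary_julia isoK).
  exists h1' => [[a [q|q]]|[[a q]|[a q]]] //=; rewrite /h1 /h1' /= ?hK ?h'K //.
exists h2' => [[a [q|q]]|[[a q]|[a q]]] //=; rewrite /h2 /h2' /= ?hK ?h'K //.
Qed.
End Dilation.

(** * Bipartite extensions of a frame *)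

Section Core.
Variable C : numClosedFieldType.
Variables P F AI AO BI BO EA EB : finType.
Variable w : vec C ((P * F) * ((AI * AO) * (BI * BO))).
Hypotheses (eqA : #|AI| = #|AO|) (eqB : #|BI| = #|BO|).
(** This is what is retained of the frame functions: contracting w with a unitary of one party
    leaves a circuit with a unitary before and a unitary after the slot of the other. *)
Hypothesis frameA : forall V : lin C BI BO, unitary V ->
  exists (Phi : lin C (AO * EA) F) (Pi : lin C P (AI * EA)),
    [/\ unitary Phi, unitary Pi & forall p f ai ao,
      \sum_bo \sum_bi V bo bi * w ((p, f), ((ai, ao), (bi, bo))) =
      \sum_e Phi f (ao, e) * Pi (ai, e) p].
Hypothesis frameB : forall U : lin C AI AO, unitary U ->
  exists (Phi : lin C (BO * EB) F) (Pi : lin C P (BI * EB)),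
    [/\ unitary Phi, unitary Pi & forall p f bi bo,
      \sum_ao \sum_ai U ao ai * w ((p, f), ((ai, ao), (bi, bo))) =
      \sum_e Phi f (bo, e) * Pi (bi, e) p].

(* The value at the matrix unit (bo, bi), on Bob's side, of the bilinear extension
   of G with K (and its ancilla) inserted on Alice's side. *)
Definition alice_op (Q1 Q2 : finType) (K : lin C (AI * Q1) (AO * Q2))
    (bo : BO) (bi : BI) : lin C (P * Q1) (F * Q2) :=
  fun y x => \sum_ao \sum_ai
    K (ao, y.2) (ai, x.2) * w ((x.1, y.1), ((ai, ao), (bi, bo))).

(** By [frameA] the contraction is the composite of Pi, K and Phi, each tensored with an
    identity. *)
Lemma alice_op_unitary (Q1 Q2 : finType) (K : lin C (AI * Q1) (AO * Q2)) :
  unitary K -> forall V, unitary V -> unitary (contract (alice_op K) V).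
Proof.
move=> uK V /frameA[Phi [Pi [uPhi uPi wV]]].
(* Exchanges E_A with the ancilla of K, so that K (x) 1 fits between Pi (x) 1 and Phi (x) 1. *)
pose s (A : finType) (Q : finType) (x : (A * EA) * Q) := ((x.1.1, x.2), x.1.2).
have bs A Q : bijective (@s A Q).
  by exists (fun x => ((x.1.1, x.2), x.1.2)) => [[[]]|[[]]].
have uK' := unitary_reindex (bs AI Q1) (bs AO Q2) (unitary_tensor uK (@unitary_id C EA)).
have := unitary_comp (unitary_tensor uPhi (@unitary_id C Q2))
  (unitary_comp uK' (unitary_tensor uPi (@unitary_id C Q1))).
congr unitary; apply: linP => -[f q'] [p q]; rewrite comp_tensor_idl sum_pair /=.
transitivity (\sum_ao \sum_ai K (ao, q') (ai, q) *
  \sum_e Phi f (ao, e) * Pi (ai, e) p).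
  apply: eq_bigr => ao _.
  under eq_bigr => e _.
    rewrite comp_tensor_idr sum_pair /= mulr_sumr.
    under eq_bigr => ai _.
      rewrite /s /tensor /idop /=.
      have -> : \sum_e' K (ao, q') (ai, q) * (e == e')%:R * Pi (ai, e') p =
          K (ao, q') (ai, q) * Pi (ai, e) p.
        under eq_bigr do rewrite mulrAC.
        under eq_bigr do rewrite eq_sym.
        by rewrite (sum_deltar e (fun e' => K (ao, q') (ai, q) * Pi (ai, e') p)).
      over.
    over.
  rewrite exchange_big; apply: eq_bigr => ai _; rewrite mulr_sumr.
  by apply: eq_bigr => e _; ring.
rewrite /contract /alice_op /=.
under eq_bigr do under eq_bigr do rewrite -wV mulr_sumr.
under [RHS]eq_bigr do under eq_bigr do rewrite mulr_sumr.
under eq_bigr => ao _ do rewrite exchange_big /=.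
rewrite exchange_big; apply: eq_bigr => bo _ /=.
under [RHS]eq_bigr => bi _ do under eq_bigr => ao _ do rewrite mulr_sumr.
rewrite [RHS]exchange_big; apply: eq_bigr => ao _ /=.
rewrite [RHS]exchange_big; apply: eq_bigr => ai _ /=.
by rewrite mulr_sumr; apply: eq_bigr => bi _; ring.
Qed.

Definition overlap_free (Q1 Q2 : finType) (K : lin C (AI * Q1) (AO * Q2)) :=
  forall i k j, i != k ->
  comp (adj (alice_op K i j)) (alice_op K k j) = @zop C (P * Q1)%type (P * Q1)%type.

(** By [frameB] the operator at (bo, bi) is a product of the block bo of Phi and the block bi of Pi,
    tensored with 1. Distinct blocks of the unitary Phi have orthogonal ranges. *)
Lemma overlap_free_local (Q : finType) (U : lin C AI AO) : unitary U ->
  overlap_free (tensor U (@idop C Q)).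
Proof.
move=> /frameB[Phi [Pi [uPhi uPi wU]]] i k j ik.
pose Phi_ b : lin C EB F := fun f e => Phi f (b, e).
pose Pi_ b : lin C P EB := fun e p => Pi (b, e) p.
have E bo bi : alice_op (tensor U (@idop C Q)) bo bi =
    tensor (comp (Phi_ bo) (Pi_ bi)) (@idop C Q).
  apply: linP => y x; rewrite /tensor /comp /Phi_ /Pi_ -wU mulr_suml.
  apply: eq_bigr => ao _; rewrite mulr_suml; apply: eq_bigr => ai _ /=.
  by rewrite mulrAC.
rewrite !E adj_tensor comp_tensor adj_comp -!compA (compA (adj (Phi_ i))).
have -> : comp (adj (Phi_ i)) (Phi_ k) = @zop C EB EB.
  apply: linP => e e'; case: uPhi => /(_ (i, e) (k, e')) + _.
  by rewrite /idop xpair_eqE (negPf ik).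
by rewrite comp0o compo0 tensor0.
Qed.

Lemma alice_op_affine (Q1 Q2 : finType) (a b : lin C (AI * Q1) (AO * Q2)) z bo bi :
  alice_op (affine a b z) bo bi = affine (alice_op a bo bi) (alice_op b bo bi) z.
Proof.
apply: linP => y x; rewrite /alice_op /affine mulr_sumr -big_split.
apply: eq_bigr => ao _ /=; rewrite mulr_sumr -big_split; apply: eq_bigr => ai _ /=.
by ring.
Qed.

Lemma comp_affine (X Y Z : finType) (K : lin C Y Z) (a b : lin C X Y) z :
  comp K (affine a b z) = affine (comp K a) (comp K b) z.
Proof.
apply: linP => y x; rewrite /comp /affine mulr_sumr -big_split.
by apply: eq_bigr => t _ /=; ring.
Qed.

(** Write U = U0 W with U0 local and W a unitary of A_I Q. Induction along circles for W starts at
    the local U0, and [affine_overlap0] carries the vanishing along each circle. *)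
Lemma overlap_free_unitary (Q : finType) (U : lin C (AI * Q) (AO * Q)) :
  unitary U -> overlap_free U.
Proof.
move=> uU; have [h [h' [hK h'K]]] := eq_card_bij eqA.
pose B : lin C AI AO := fun y x => (h' y == x)%:R.
have uB : unitary B by apply: unitary_perm; exists h.
pose U0 := tensor B (@idop C Q).
have uU0 : unitary U0 by apply: unitary_tensor uB (unitary_id C Q).
have <- : comp U0 (comp (adj U0) U) = U.
  have [_] := iffLR (unitaryP _) uU0; rewrite /isometry adjK compA => ->.
  by rewrite comp1o.
apply: (unitary_ind (Q := fun W => overlap_free (comp U0 W))); last first.
- exact: unitary_comp (unitary_adj uU0) uU.
- move=> a b uab H1 z z1 i k j ik; rewrite comp_affine !alice_op_affine.
  apply: affine_overlap0 z1 => [y y1|].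
    rewrite -!alice_op_affine -comp_affine.
    apply: (overlap_partial_isometry eqB _ _ ik); apply: alice_op_unitary.
    exact: unitary_comp uU0 (uab _ y1).
  by rewrite -!alice_op_affine -comp_affine; apply: H1.
by rewrite compo1; apply: overlap_free_local.
Qed.

Section Isometry.
Variables (Q1 Q2 : finType) (K : lin C (AI * Q1) (AO * Q2)).
Hypothesis isoK : isometry K.

(** Each relation is inherited from a unitary dilation of K. *)
Lemma alice_op_gram :
  [/\ forall i k j l, i != k ->
        comp (adj (alice_op K i j)) (alice_op K k l) = @zop C (P * Q1)%type (P * Q1)%type,
      forall i k j l, comp (adj (alice_op K i j)) (alice_op K i l) =
        comp (adj (alice_op K k j)) (alice_op K k l) &
      forall (s : BI -> BO) x x', bijective s ->
        \sum_j comp (adj (alice_op K (s j) j)) (alice_op K (s j) j) x x' =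
        (x == x')%:R].
Proof.
have [U [uU UK U0]] := isometry_dilation eqA isoK.
(* On [inl] inputs the dilation has zero [inl] outputs and reproduces K on [inr] outputs. *)
have E i j k l x x' : comp (adj (alice_op K i j)) (alice_op K k l) x x' =
    comp (adj (alice_op U i j)) (alice_op U k l) (x.1, inl x.2) (x'.1, inl x'.2).
  rewrite /comp !sum_pair; apply: eq_bigr => f _; rewrite big_sumType /=.
  rewrite [X in _ = X + _]big1 ?add0r => [|q _].
    apply: eq_bigr => q _; rewrite /adj /alice_op /=.
    by congr (_^* * _); apply: eq_bigr => ao _; apply: eq_bigr => ai _; rewrite UK.
  rewrite /adj /alice_op /= [X in _ * X]big1 ?mulr0 // => ao _.
  by apply: big1 => ai _; rewrite U0 mul0r.
have H := alice_op_unitary uU; have O := overlap_free_unitary uU.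
split=> [i k j l ik|i k j l|s x x' bs].
- by apply: linP => x x'; rewrite E (gram_offdiag eqB H O).
- by apply: linP => x x'; rewrite !E (gram_diag eqB H O i k).
- under eq_bigr do rewrite E.
  by rewrite (unit_perm_initial H) // /eq_op /= /eq_op /=.
Qed.

Variables (R1 R2 : finType) (L : lin C (BI * R1) (BO * R2)).
Hypothesis isoL : isometry L.

(** The bilinear extension of G with both local operations inserted and their ancillas carried
    along. *)
Definition plug : lin C ((P * Q1) * R1) ((F * Q2) * R2) :=
  fun y x => \sum_bo \sum_bi L (bo, y.2) (bi, x.2) * alice_op K bo bi y.1 x.1.

Lemma isometry_plug : isometry plug.
Proof.
have [offdiag diag perm1] := alice_op_gram.
have [h [h' [hK h'K]]] := eq_card_bij eqB.
have bh : bijective h by exists h'.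
apply: linP => -[x r] [x' r'].
pose LL bo bi bo' bi' := \sum_(t : R2) (L (bo, t) (bi, r))^* * L (bo', t) (bi', r').
pose G bo bi bo' bi' := comp (adj (alice_op K bo bi)) (alice_op K bo' bi') x x'.
transitivity (\sum_bo \sum_bo' \sum_bi \sum_bi' LL bo bi bo' bi' * G bo bi bo' bi').
  rewrite /comp sum_pair exchange_big /adj /plug /=.
  under eq_bigr => t _. under eq_bigr => y _.
    rewrite conj_sum big_distrlr /=.
    under eq_bigr => bo _. under eq_bigr => bo' _.
      rewrite conj_sum big_distrlr /=.
      under eq_bigr => bi _. under eq_bigr => bi' _ do rewrite conjM mulrACA.
      over. over. over. over. over.
  under eq_bigr do rewrite exchange_big /=.
  rewrite exchange_big; apply: eq_bigr => bo _ /=.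
  under eq_bigr do rewrite exchange_big /=.
  rewrite exchange_big; apply: eq_bigr => bo' _ /=.
  under eq_bigr do rewrite exchange_big /=.
  rewrite exchange_big; apply: eq_bigr => bi _ /=.
  under eq_bigr do rewrite exchange_big /=.
  rewrite exchange_big; apply: eq_bigr => bi' _ /=.
  rewrite /LL /G /comp big_distrlr /=.
  by apply: eq_bigr => t _; apply: eq_bigr => y _.
(* Terms with bo <> bo' vanish, and G does not depend on the common row. Row [h bi] is chosen so
   that, once the sum over bo has produced [adj L] L = 1, a permutation sum remains. *)
transitivity (\sum_bo \sum_bi \sum_bi' LL bo bi bo bi' * G (h bi) bi (h bi) bi').
  apply: eq_bigr => bo _; rewrite (bigD1 bo) //= [X in _ + X]big1 ?addr0.
    apply: eq_bigr => bi _; apply: eq_bigr => bi' _.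
    by rewrite /G (diag bo (h bi)).
  move=> bo' bo'o; apply: big1 => bi _; apply: big1 => bi' _.
  by rewrite /G offdiag 1?eq_sym // mulr0.
rewrite exchange_big /=.
transitivity (\sum_bi \sum_bi' (bi == bi')%:R * ((r == r')%:R * G (h bi) bi (h bi) bi')).
  apply: eq_bigr => bi _; rewrite exchange_big; apply: eq_bigr => bi' _ /=.
  rewrite -mulr_suml mulrA; congr (_ * _).
  by rewrite -natrM mulnb -xpair_eqE -(isometryE isoL) sum_pair.
under eq_bigr do rewrite sum_delta.
by rewrite -mulr_sumr perm1 // -natrM mulnb andbC -xpair_eqE.
Qed.
End Isometry.
End Core.

(** * Kraus decompositions and links *)

Section Kraus.
Variable C : numClosedFieldType.
Variables X Y : finType.

Definition kraus (I : finType) (T : I -> lin C X Y) : superop C X Y :=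
  fun Z y y' => \sum_i comp (T i) (comp Z (adj (T i))) y y'.

Lemma choi_kraus (I : finType) (T : I -> lin C X Y) p q :
  choi (kraus T) p q = \sum_i proj (dket (T i)) p q.
Proof.
apply: eq_bigr => i _; rewrite /proj /dket /comp (bigD1 p.1) //= [X in _ + X]big1.
  rewrite addr0; congr (_ * _); rewrite (bigD1 q.1) //= big1 => [|x /negPf->].
    by rewrite !eqxx mul1r addr0.
  by rewrite andbF mul0r.
by move=> x /negPf->; rewrite big1 ?mulr0 // => x' _; rewrite mul0r.
Qed.

Lemma choi_unitary_channel (T : lin C X Y) p q :
  choi (unitary_channel T) p q = proj (dket T) p q.
Proof.
have := choi_kraus (fun _ : unit => T) p q; rewrite big_const card_unit /= addr0 => <-.
by rewrite /choi /kraus big_const card_unit /= addr0.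
Qed.

Lemma kraus_CPTP (I : finType) (T : I -> lin C X Y) :
  (forall x x', \sum_i \sum_y (T i y x)^* * T i y x' = (x == x')%:R) ->
  CPTP (kraus T).
Proof.
move=> T1; split.
- move=> a Z1 Z2 y y'; rewrite /kraus mulr_sumr -big_split; apply: eq_bigr => i _ /=.
  rewrite /comp mulr_sumr -big_split; apply: eq_bigr => x _ /=.
  rewrite mulrCA -mulrDr; congr (_ * _).
  by rewrite mulr_sumr -big_split; apply: eq_bigr => x' _ /=; ring.
- move=> R Z psdZ v.
  (* This is [adj (T i)] (x) 1 applied to v, so each Kraus term is a value of the form of Z. *)
  pose u i (z : X * R) := \sum_y (T i y z.1)^* * v (y, z.2).
  have -> : \sum_t \sum_t' (v t)^* * ext_sop (kraus T) Z t t' * v t' =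
      \sum_i \sum_z \sum_z' (u i z)^* * Z z z' * u i z'.
    transitivity (\sum_t \sum_t' \sum_i \sum_x \sum_x'
        (T i t.1 x * (v t)^*) * Z (x, t.2) (x', t'.2) * ((T i t'.1 x')^* * v t')).
      apply: eq_bigr => t _; apply: eq_bigr => t' _.
      rewrite /ext_sop /kraus /comp mulr_sumr mulr_suml; apply: eq_bigr => i _.
      rewrite mulr_sumr mulr_suml; apply: eq_bigr => x _.
      rewrite !mulr_sumr mulr_suml; apply: eq_bigr => x' _.
      by rewrite /adj; ring.
    under eq_bigr do rewrite exchange_big /=.
    rewrite exchange_big; apply: eq_bigr => i _ /=.
    under eq_bigr do rewrite exchange_big /=.
    rewrite exchange_big sum_pair; apply: eq_bigr => x _ /=.
    under eq_bigr do rewrite exchange_big /=.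
    rewrite exchange_big /=.
    under [RHS]eq_bigr do rewrite sum_pair.
    rewrite [RHS]exchange_big; apply: eq_bigr => x' _ /=.
    rewrite sum_pair exchange_big; apply: eq_bigr => r _ /=.
    under eq_bigr do rewrite sum_pair exchange_big /=.
    rewrite exchange_big; apply: eq_bigr => r' _ /=.
    rewrite /u /= conj_sum -mulrA mulr_suml; apply: eq_bigr => y _ /=.
    rewrite !mulr_sumr; apply: eq_bigr => y' _ /=.
    by rewrite conjM conjCK; ring.
  by apply: sumr_ge0 => i _; apply: psdZ.
- move=> Z; rewrite /trace /kraus /comp.
  transitivity (\sum_x \sum_x' Z x x' * \sum_i \sum_y (T i y x')^* * T i y x).
    rewrite exchange_big /=.
    under eq_bigr do rewrite exchange_big /=.
    under eq_bigr do under eq_bigr do under eq_bigr do rewrite mulr_sumr.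
    rewrite exchange_big; apply: eq_bigr => x _ /=.
    under eq_bigr do rewrite exchange_big /=.
    under [RHS]eq_bigr do rewrite mulr_sumr.
    rewrite [RHS]exchange_big; apply: eq_bigr => i _ /=.
    apply: eq_bigr => x' _; rewrite mulr_sumr; apply: eq_bigr => y _.
    by rewrite /adj; ring.
  apply: eq_bigr => x _; under eq_bigr do rewrite T1.
  by rewrite sum_deltar.
Qed.

(** The Choi operator is positive, being the image of a positive operator under M (x) 1; the vectors
    of a rank-one decomposition are the Kraus operators. *)
Lemma CPTP_kraus (M : superop C X Y) : CPTP M ->
  exists T : Y * X -> lin C X Y,
    choi M = (fun p q => \sum_i proj (dket (T i)) p q) /\
    forall x x', \sum_i \sum_y (T i y x)^* * T i y x' = (x == x')%:R.
Proof.
case=> _ cpM tpM.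
(* The unnormalized projector on the maximally entangled vector. *)
pose Z : lin C (X * X) (X * X) := fun p q => ((p.1 == p.2) && (q.1 == q.2))%:R.
have psdZ : psd Z.
  move=> v; have -> : \sum_t \sum_t' (v t)^* * Z t t' * v t' =
      (\sum_t (t.1 == t.2)%:R * v t)^* * \sum_t (t.1 == t.2)%:R * v t.
    rewrite conj_sum big_distrlr; apply: eq_bigr => t _; apply: eq_bigr => t' _ /=.
    by rewrite /Z -mulnb natrM conjM conjC_nat; ring.
  by rewrite mulrC mul_conjC_ge0.
have [v vE] := psd_decomposition (cpM _ _ psdZ).
pose T k : lin C X Y := fun y x => v k (y, x).
have choiE : choi M = fun p q => \sum_k proj (dket (T k)) p q.
  apply: linP => -[x y] [x' y'].
  by rewrite -[RHS](vE (y, x) (y', x')) /ext_sop /choi.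
exists T; split=> // x x'.
(* Trace preservation at the matrix unit |x'><x| is the (x, x') entry of the completeness
   relation. *)
have := tpM (fun z z' => ((z == x') && (z' == x))%:R).
have -> : trace (fun z z' : X => ((z == x') && (z' == x))%:R : C) = (x == x')%:R.
  rewrite /trace (bigD1 x) //= big1 => [|z /negPf->]; last by rewrite andbF.
  by rewrite eqxx andbT addr0.
move=> <-; rewrite exchange_big; apply: eq_bigr => y _ /=.
have -> : M (fun z z' => ((z == x') && (z' == x))%:R) y y = choi M (x', y) (x, y) by [].
by rewrite choiE; apply: eq_bigr => k _; rewrite mulrC.
Qed.
End Kraus.

Section Link.
Variable C : numClosedFieldType.
Variables P F AI AO BI BO AI' AO' BI' BO' : finType.
Variable w : vec C ((P * F) * ((AI * AO) * (BI * BO))).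

Definition link_vec (k : vec C ((AI * AI') * (AO * AO')))
    (l : vec C ((BI * BI') * (BO * BO'))) :
    vec C ((P * F) * ((AI' * AO') * (BI' * BO'))) :=
  fun x => \sum_ab w (x.1, ab) *
    (k ((ab.1.1, x.2.1.1), (ab.1.2, x.2.1.2)) *
     l ((ab.2.1, x.2.2.1), (ab.2.2, x.2.2.2))).

(** The partial transpose pairs the row indices of W with those of the local operators, so the
    double sum factors into a vector and its conjugate. *)
Lemma link_proj k l : link (proj w) (proj k) (proj l) = proj (link_vec k l).
Proof.
apply: linP => x y; rewrite /link /proj /link_vec /ptransAB /= conj_sum.
rewrite big_distrlr exchange_big; apply: eq_bigr => ab _; apply: eq_bigr => ab' _ /=.
by rewrite !conjM; ring.
Qed.

Lemma link_sum (W : lin C ((P * F) * ((AI * AO) * (BI * BO))) _) (I J : finType)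
    (Mx : I -> lin C ((AI * AI') * (AO * AO')) _)
    (My : J -> lin C ((BI * BI') * (BO * BO')) _) :
  link W (fun p q => \sum_i Mx i p q) (fun p q => \sum_j My j p q) =
  fun x y => \sum_(ij : I * J) link W (Mx ij.1) (My ij.2) x y.
Proof.
apply: linP => x y; rewrite /link.
under eq_bigr do under eq_bigr do rewrite big_distrlr pair_big mulr_sumr.
under eq_bigr do rewrite exchange_big /=.
by rewrite exchange_big.
Qed.

Lemma link_vec_dket (K : lin C (AI * AI') (AO * AO')) (L : lin C (BI * BI') (BO * BO'))
    p f ai ao bi bo :
  link_vec (dket K) (dket L) ((p, f), ((ai, ao), (bi, bo))) =
  plug w K L ((f, ao), bo) ((p, ai), bi).
Proof.
rewrite /link_vec /plug /alice_op /dket sum_pair exchange_big sum_pair exchange_big.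
apply: eq_bigr => b _; apply: eq_bigr => b' _ /=; rewrite sum_pair exchange_big mulr_sumr.
apply: eq_bigr => a _; rewrite mulr_sumr; apply: eq_bigr => a' _ /=.
by ring.
Qed.
End Link.

(** * The tensor of two consistent frame functions *)

Section Resolution.
Variable C : numClosedFieldType.
Variables X Y : finType.
Variables (n : nat) (U : 'I_n -> lin C X Y).
Hypothesis onbU : onb_unitaries U.

(** Pairing the basis expansion of K with U_i isolates d times its coefficient; d is invertible
    because x inhabits X. *)
Lemma onb_expand (K : lin C X Y) y x :
  K y x = \sum_i (#|X|%:R^-1 * inner (dket (U i)) (dket K)) * U i y x.
Proof.
have [_ _ _ [_ /(_ (dket K))[c cE]] orth] := onbU.
rewrite -[LHS]/(dket K (x, y)) cE; apply: eq_bigr => i _; congr (_ * _).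
have X0 : #|X|%:R != 0 :> C.
  by rewrite pnatr_eq0 -lt0n; apply/card_gt0P; exists x.
apply: (mulfI X0); rewrite mulVKf // /inner.
under eq_bigr do rewrite cE mulr_sumr.
rewrite exchange_big (bigD1 i) //= [X in _ + X]big1 ?addr0 => [|j ji].
  under eq_bigr do rewrite mulrCA.
  rewrite -mulr_sumr -[\sum_t _]/(inner (dket (U i)) (dket (U i))) orth eqxx muln1.
  by rewrite mulrC.
under eq_bigr do rewrite mulrCA.
rewrite -mulr_sumr -[\sum_t _]/(inner (dket (U i)) (dket (U j))) orth.
by rewrite eq_sym (negPf ji) muln0 mulr0.
Qed.

(* The weights conj(U_i y x) / d invert the expansion of a linear functional of
   U_i along the matrix units. *)
Lemma onb_coefficient (h : Y -> X -> C) y x :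
  \sum_i (#|X|%:R^-1 * (U i y x)^*) * (\sum_y' \sum_x' U i y' x' * h y' x') = h y x.
Proof.
(* The matrix unit at (y, x), whose expansion has exactly these weights as coefficients. *)
pose E : lin C X Y := fun y' x' => (y == y')%:R * (x == x')%:R.
have innerE i : inner (dket (U i)) (dket E) = (U i y x)^*.
  rewrite /inner sum_pair /dket /E /= exchange_big /=.
  under eq_bigr do under eq_bigr do rewrite mulrCA mulrC.
  transitivity (\sum_y' (y == y')%:R * \sum_x' (x == x')%:R * (U i y' x')^*).
    apply: eq_bigr => y' _; rewrite mulr_sumr; apply: eq_bigr => x' _.
    by ring.
  by rewrite !sum_delta.
transitivity (\sum_y' \sum_x' E y' x' * h y' x').
  under [RHS]eq_bigr do under eq_bigr do rewrite onb_expand mulr_suml.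
  under [RHS]eq_bigr do rewrite exchange_big /=.
  rewrite [RHS]exchange_big; apply: eq_bigr => i _ /=.
  rewrite mulr_sumr; apply: eq_bigr => y' _; rewrite mulr_sumr.
  by apply: eq_bigr => x' _; rewrite innerE; ring.
under eq_bigr do under eq_bigr do rewrite -mulrA.
under eq_bigr do rewrite -mulr_sumr.
by rewrite !sum_delta.
Qed.
End Resolution.

Section Frames.
Variable C : numClosedFieldType.

Lemma GA_sum (P F AI AO BI BO EA : finType)
    (PiA : lin C BI BO -> lin C P (AI * EA)) (PhiA : lin C BI BO -> lin C (AO * EA) F)
    U V f p :
  GA PiA PhiA U V f p =
  \sum_ao \sum_ai U ao ai * \sum_e PhiA V f (ao, e) * PiA V (ai, e) p.
Proof.
rewrite /GA /comp /tensor /idop sum_pair; apply: eq_bigr => ao _ /=.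
under eq_bigr => e _.
  rewrite sum_pair mulr_sumr /=.
  under eq_bigr => ai _.
    under eq_bigr do rewrite [U _ _ * _]mulrC -mulrA.
    rewrite sum_delta.
    over.
  over.
rewrite exchange_big; apply: eq_bigr => ai _ /=; rewrite mulr_sumr.
by apply: eq_bigr => e _; ring.
Qed.

Variables P F AI AO BI BO EA EB : finType.
Variables (PiA : lin C BI BO -> lin C P (AI * EA))
  (PhiA : lin C BI BO -> lin C (AO * EA) F)
  (PiB : lin C AI AO -> lin C P (BI * EB))
  (PhiB : lin C AI AO -> lin C (BO * EB) F).
Hypothesis hcons : forall UA UB, unitary UA -> unitary UB ->
  forall f p, GA PiA PhiA UA UB f p = GB PiB PhiB UA UB f p.
Variables (n m : nat) (U : 'I_n -> lin C AI AO) (V : 'I_m -> lin C BI BO).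
Hypotheses (onbU : onb_unitaries U) (onbV : onb_unitaries V).

Let gA (W : lin C BI BO) f p ao ai := \sum_e PhiA W f (ao, e) * PiA W (ai, e) p.
Let gB (W : lin C AI AO) f p bo bi := \sum_e PhiB W f (bo, e) * PiB W (bi, e) p.

Lemma GB_sum UA UB f p :
  GB PiB PhiB UA UB f p = \sum_bo \sum_bi UB bo bi * gB UA f p bo bi.
Proof. exact: (GA_sum PiB PhiB UB UA). Qed.

(** The normalization is split so that each party carries the weights of [onb_coefficient]. *)
Lemma wvecE p f ai ao bi bo :
  wvec PiA PhiA U V ((p, f), ((ai, ao), (bi, bo))) =
  \sum_i \sum_j (#|AI|%:R^-1 * (U i ao ai)^*) * ((#|BI|%:R^-1 * (V j bo bi)^*) *
    GA PiA PhiA (U i) (V j) f p).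
Proof.
rewrite /wvec mulr_sumr; apply: eq_bigr => i _; rewrite mulr_sumr.
apply: eq_bigr => j _; rewrite /dket /cconj /= natrM invfM; ring.
Qed.

Let uU i : unitary (U i). Proof. by case: onbU. Qed.
Let uV j : unitary (V j). Proof. by case: onbV. Qed.

(** Consistency is used twice. It makes G(U_i, V_j) linear in V_j, so the sum over j extracts Bob's
    coefficients, and contraction with W recovers G(U_i, W). Read as linear in U_i, this lets the
    sum over i extract Alice's coefficients. *)
Lemma wvec_alice W p f ai ao : unitary W ->
  \sum_bo \sum_bi W bo bi * wvec PiA PhiA U V ((p, f), ((ai, ao), (bi, bo))) =
  gA W f p ao ai.
Proof.
move=> uW; rewrite -[RHS](onb_coefficient onbU (gA W f p) ao ai).
transitivity (\sum_bo \sum_bi \sum_i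
    (#|AI|%:R^-1 * (U i ao ai)^*) * (W bo bi * gB (U i) f p bo bi)).
  apply: eq_bigr => bo _; apply: eq_bigr => bi _; rewrite wvecE mulr_sumr.
  apply: eq_bigr => i _; rewrite -(onb_coefficient onbV (gB (U i) f p) bo bi).
  rewrite !mulr_sumr; apply: eq_bigr => j _.
  by rewrite hcons // GB_sum; ring.
under eq_bigr do rewrite exchange_big /=.
rewrite exchange_big; apply: eq_bigr => i _ /=.
rewrite -GA_sum hcons // GB_sum mulr_sumr.
by apply: eq_bigr => bo _; rewrite mulr_sumr.
Qed.

(** The same argument with the sum over i performed first. *)
Lemma wvec_bob W p f bi bo : unitary W ->
  \sum_ao \sum_ai W ao ai * wvec PiA PhiA U V ((p, f), ((ai, ao), (bi, bo))) =
  gB W f p bo bi.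
Proof.
move=> uW; rewrite -[RHS](onb_coefficient onbV (gB W f p) bo bi).
transitivity (\sum_ao \sum_ai \sum_j
    (#|BI|%:R^-1 * (V j bo bi)^*) * (W ao ai * gA (V j) f p ao ai)).
  apply: eq_bigr => ao _; apply: eq_bigr => ai _; rewrite wvecE exchange_big mulr_sumr.
  apply: eq_bigr => j _; rewrite -(onb_coefficient onbU (gA (V j) f p) ao ai).
  rewrite !mulr_sumr; apply: eq_bigr => i _.
  by rewrite GA_sum; ring.
under eq_bigr do rewrite exchange_big /=.
rewrite exchange_big; apply: eq_bigr => j _ /=.
rewrite -GB_sum -hcons // GA_sum mulr_sumr.
by apply: eq_bigr => ao _; rewrite mulr_sumr.
Qed.
End Frames.

(** * Validity and purity from preservation of isometries *)

Section Processes.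
Variable C : numClosedFieldType.
Variables P F AI AO BI BO : finType.
Variable w : vec C ((P * F) * ((AI * AO) * (BI * BO))).
Hypothesis isometry_w : forall (Q1 Q2 R1 R2 : finType)
  (K : lin C (AI * Q1) (AO * Q2)) (L : lin C (BI * R1) (BO * R2)),
  isometry K -> isometry L -> isometry (plug w K L).

(** Stinespring: the Kraus index is recorded in the output ancilla. *)
Lemma kraus_isometry (I X Y Z : finType) (T : I -> lin C X (Y * Z)) :
  (forall x x', \sum_i \sum_y (T i y x)^* * T i y x' = (x == x')%:R) ->
  isometry ((fun y x => T y.2.2 (y.1, y.2.1) x) : lin C X (Y * (Z * I))).
Proof.
move=> T1; apply: linP => x x'; rewrite /idop -T1 /comp /adj sum_pair.
under eq_bigr do rewrite sum_pair exchange_big /=.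
by rewrite exchange_big; apply: eq_bigr => i _; rewrite sum_pair.
Qed.

Lemma process_matrix_of_isometry : process_matrix (proj w).
Proof.
move=> AI' AO' BI' BO' Mx My /CPTP_kraus[Kx [choiMx Kx1]] /CPTP_kraus[Ky [choiMy Ky1]].
set I := (_ * _)%type in Kx choiMx Kx1; set J := (_ * _)%type in Ky choiMy Ky1.
pose K : lin C (AI * AI') (AO * (AO' * I)) := fun y x => Kx y.2.2 (y.1, y.2.1) x.
pose L : lin C (BI * BI') (BO * (BO' * J)) := fun y x => Ky y.2.2 (y.1, y.2.1) x.
have isoT := isometry_w (kraus_isometry Kx1) (kraus_isometry Ky1).
rewrite -/K -/L in isoT.
(* The Kraus operators of the resulting channel are the blocks of the big isometry at fixed values
   of the two recorded Kraus indices. *)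
pose T (ij : I * J) : lin C ((P * AI') * BI') ((F * AO') * BO') :=
  fun y x => plug w K L ((y.1.1, (y.1.2, ij.1)), (y.2, ij.2)) x.
exists (kraus T); split.
  apply: kraus_CPTP => x x'; rewrite -(isometryE isoT) /T.
  rewrite pair_bigA /= [RHS](reindex (fun q : (I * J) * ((F * AO') * BO') =>
    ((q.2.1.1, (q.2.1.2, q.1.1)), (q.2.2, q.1.2)))) //=.
  apply: onW_bij; exists (fun z => ((z.1.2.2, z.2.2), ((z.1.1, z.1.2.1), z.2.1))).
    by move=> [[i j] [[f ao] bo]].
  by move=> [[f [ao i]] [bo j]].
move=> p f ai ao bi bo p2 f2 ai2 ao2 bi2 bo2.
rewrite choiMx choiMy link_sum choi_kraus; apply: eq_bigr => -[i j] _ /=.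
by rewrite link_proj /proj !link_vec_dket.
Qed.

(** The dimension equality makes the isometry [plug w U V] square, hence unitary. *)
Lemma pure_process_of_isometry : pure_process (proj w).
Proof.
move=> AI' AO' BI' BO' eqA eqB eqPF U V /unitaryP[isoU _] /unitaryP[isoV _].
exists (plug w U V); split.
  apply: isometry_square_unitary; last exact: isometry_w.
  by rewrite !card_prod.
move=> p f ai ao bi bo p2 f2 ai2 ao2 bi2 bo2.
by rewrite link_proj /proj !link_vec_dket choi_unitary_channel.
Qed.
End Processes.

Theorem theorem2 (C : numClosedFieldType) (P F AI AO BI BO EA EB : finType)
  (hA : #|AI| = #|AO|) (hB : #|BI| = #|BO|)
  (hPF : #|P| = #|F|) (hPA : #|P| = (#|AI| * #|EA|)%N)
  (hPB : #|P| = (#|BI| * #|EB|)%N)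
  (PiA : lin C BI BO -> lin C P (AI * EA)) (PhiA : lin C BI BO -> lin C (AO * EA) F)
  (PiB : lin C AI AO -> lin C P (BI * EB)) (PhiB : lin C AI AO -> lin C (BO * EB) F)
  (hfA : frame_fun_A PiA PhiA) (hfB : frame_fun_B PiB PhiB)
  (hcons : forall (UA : lin C AI AO) (UB : lin C BI BO),
      unitary UA -> unitary UB ->
      forall f p, GA PiA PhiA UA UB f p = GB PiB PhiB UA UB f p)
  (U : 'I_(#|AI| ^ 2) -> lin C AI AO) (V : 'I_(#|BI| ^ 2) -> lin C BI BO)
  (hU : onb_unitaries U) (hV : onb_unitaries V) :
  let W := proj (wvec PiA PhiA U V) in
  process_matrix W /\ pure_process W.
Proof.
have iso (Q1 Q2 R1 R2 : finType) (K : lin C (AI * Q1) (AO * Q2))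
    (L : lin C (BI * R1) (BO * R2)) :
    isometry K -> isometry L -> isometry (plug (wvec PiA PhiA U V) K L).
  move=> isoK isoL.
  apply: (isometry_plug (EA := EA) (EB := EB) hA hB _ _ isoK isoL) => W uW.
    exists (PhiA W), (PiA W); have [uPi uPhi] := hfA W uW.
    by split=> // p f ai ao; apply: (wvec_alice hcons hU hV).
  exists (PhiB W), (PiB W); have [uPi uPhi] := hfB W uW.
  by split=> // p f bi bo; apply: (wvec_bob hcons hU hV).
split; [exact: process_matrix_of_isometry|exact: pure_process_of_isometry].
Qed.
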